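(* Let $\Gamma$ be a trivalent tree with six leaves labeled bijectively by the monomials $x^2, xy, y^2, yz, z^2, xz$. Then $\Gamma$ is realizable by a pencil of conics if and only if $\Gamma$ can be embedded as a planar graph into the unit disc such that the six labeled leaves are located in the cyclic order $x^2, xy, y^2, yz, z^2, xz$ on the boundary of the disc.
   Context: Tropical arithmetic: $x\oplus y=\min\{x,y\}$, $x\odot y=x+y$ on $\mathbb{R}$. Tropical projective space is $\mathbb{TP}^{m-1}=\mathbb{R}^m/\mathbb{R}(1,\dots,1)$. A point $a=(a_1,\dots,a_6)\in\mathbb{TP}^5$ is identified with the tropical conic given by $F_a(x,y,z)=\min\{a_1+2x,\;a_2+x+y,\;a_3+2y,\;a_4+y+z,\;a_5+2z,\;a_6+x+z\}$; a point $(x,y,z)\in\mathbb{TP}^2$ lies on the conic if this minimum is attained at least twice. The coordinates $a_1,\dots,a_6$ are thus labeled by $x^2,xy,y^2,yz,z^2,xz$ respectively. For a real $k\times k$ matrix $A=(a_{ij})$, the tropical determinant is $\min_{\sigma\in S_k}(a_{1\sigma_1}+\dots+a_{k\sigma_k})$; $A$ is tropically singular if this minimum is attained by at least two permutations. Let $P_i=(x_i,y_i,z_i)\in\mathbb{TP}^2$, $1\le i\le 4$, be four points such that all $4\times4$ submatrices of the $4\times 6$ matrix with rows $(2x_i,\,x_i+y_i,\,2y_i,\,y_i+z_i,\,2z_i,\,x_i+z_i)$ are tropically nonsingular (genericity). Then the set of all $a\in\mathbb{TP}^5$ whose conic passes through $P_1,\dots,P_4$ is a tropical line in $\mathbb{TP}^5$,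 called the pencil of conics. A tropical line in $\mathbb{TP}^{5}$ is an embedded tree whose edges are bounded segments or unbounded half rays, such that all edge directions are spanned by integer vectors, there are precisely six unbounded half rays and their directions are the six coordinate directions $e_1,\dots,e_6$, and at every vertex the primitive integer vectors of the outgoing edges sum to $0$. Regarding the half rays as leaves, with the half ray in direction $e_i$ labeled by the monomial of the coordinate $a_i$, the line is a tree with six labeled leaves. A tree $\Gamma$ with leaves labeled $x^2,xy,y^2,yz,z^2,xz$ is realizable by a pencil of conics if there is a configuration of four points $P_i=(x_i,y_i,z_i)\in\mathbb{TP}^2$, $1\le i\le 4$, for which all $4\times4$ submatrices of the $4\times 6$ matrix with rows $(2x_i,\,x_i+y_i,\,2y_i,\,y_i+z_i,\,2z_i,\,x_i+z_i)$ are tropically nonsingular, and whose pencil of conics is combinatorially (as a leaf-labeled tree) equal to $\Gamma$. *)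

(* Defs.v *)
From HB Require Import structures.
From mathcomp Require Import all_boot all_order all_algebra all_fingroup.
From mathcomp Require Import all_classical all_reals all_analysis.

Set Implicit Arguments.
Unset Strict Implicit.
Unset Printing Implicit Defensive.

Import Order.TTheory GRing.Theory Num.Theory.
Import numFieldNormedType.Exports.

Local Open Scope classical_set_scope.
Local Open Scope ring_scope.

(** * Leaf-labelled trees *)

Record ltree (n : nat) := LTree {
  vert :> finType;
  adj : rel vert;
  leaf : 'I_n -> vert;
  adj_sym : symmetric adj;
  adj_irr : irreflexive adj;
  adj_connected : forall u v, connect adj u v;
  adj_acyclic : forall c : seq vert, (2 < size c)%N -> ~ ucycle adj c;
  leaf_inj : injective leaf;
  leafP : forall v, (v \in codom leaf) = (#|adj v| == 1%N) }.

Definition inner n (T : ltree n) (v : T) : bool := v \notin codom (@leaf n T).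

Definition trivalent n (T : ltree n) : Prop :=
  forall v : T, inner v -> #|adj v| = 3%N.

Definition ltree_iso n (T1 T2 : ltree n) : Prop :=
  exists f : T1 -> T2,
    [/\ bijective f,
        forall u v, adj (f u) (f v) = adj u v &
        forall i, f (leaf T1 i) = leaf T2 i].

Definition same_edge (V : Type) (u v u' v' : V) : Prop :=
  (u = u' /\ v = v') \/ (u = v' /\ v = u').

(** * Tropical projective space and tropical lines *)

(* Points of R^n / R(1,...,1) are given by representatives in 'rV[R]_n; all
   predicates below are invariant under [tpeq].  With R := int this is also
   equality in the lattice Z^n / Z(1,...,1) of integer directions. *)
Definition tpeq (R : pzRingType) n (u v : 'rV[R]_n) : Prop :=
  exists c : R, v = u + const_mx c.

(* Primitive in the lattice Z^n / Z(1,...,1); excludes 0 (take k = 0). *)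
Definition primitive n (d : 'rV[int]_n) : Prop :=
  forall (k : int) (d' : 'rV[int]_n), tpeq d (k *: d') -> `|k| = 1.

Section TropicalLine.
Variables (R : realType) (n : nat) (T : ltree n).
(* Positions of the vertices.  Leaves stand for the ends at infinity of the
   half rays: their positions are never used. *)
Variable pos : T -> 'rV[R]_n.

(* The closed edge from the inner vertex v towards its neighbour w: the half
   ray pos v + R_{>=0} e_i if w is the leaf i, a bounded segment otherwise. *)
Definition cell (v w : T) : set 'rV[R]_n := [set a |
  (exists i (t : R), [/\ w = leaf T i, 0 <= t &
     tpeq a (pos v + t *: delta_mx 0 i)]) \/
  (inner w /\ exists t : R, [/\ 0 <= t, t <= 1 &
     tpeq a (pos v + t *: (pos w - pos v))])].

(* d is the primitive integer vector of the edge leaving v towards w. *)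
Definition out_direction (v w : T) (d : 'rV[int]_n) : Prop :=
  primitive d /\
  ((exists2 i, w = leaf T i & tpeq d (delta_mx 0 i)) \/
   (inner w /\ exists2 c : R, 0 < c &
      tpeq (pos w) (pos v + c *: map_mx intr d))).

Definition balanced (v : T) : Prop :=
  exists d : T -> 'rV[int]_n,
    (forall w, adj v w -> out_direction v w (d w)) /\
    tpeq (\sum_(w | adj v w) d w) 0.

(* As every inner vertex is an end of some edge, the second clause also keeps
   inner vertices off the edges not incident to them. *)
Definition embedded : Prop :=
  (forall v w : T, inner v -> inner w -> tpeq (pos v) (pos w) -> v = w) /\
  (forall v w v' w' : T, inner v -> inner v' -> adj v w -> adj v' w' ->
     ~ same_edge v w v' w' ->
     forall a, cell v w a -> cell v' w' a ->
     exists u : T, [/\ inner u, u = v \/ u = w, u = v' \/ u = w' &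
                      tpeq a (pos u)]).

Definition tropical_line : Prop :=
  embedded /\ (forall v : T, inner v -> balanced v).

Definition line_support : set 'rV[R]_n :=
  [set a | exists v w : T, [/\ inner v, adj v w & cell v w a]].

End TropicalLine.

(** * Pencils of tropical conics *)

Definition min_attained_twice (R : realType) (I : finType) (f : I -> R) : Prop :=
  exists i j : I, [/\ i != j, f i = f j & forall k, f i <= f k].

Definition trop_singular (R : realType) k (A : 'M[R]_k) : Prop :=
  min_attained_twice (fun s : 'S_k => \sum_(i < k) A i (s i)).

(* The tropical values at p = (x, y, z) of the six monomials, in the order
   x^2, xy, y^2, yz, z^2, xz; the label i : 'I_6 stands for the i-th of them. *)
Definition monomials (R : realType) (p : 'rV[R]_3) : seq R :=
  let x := p 0 0 in let y := p 0 1 in let z := p 0 2%:R in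
  [:: 2 * x; x + y; 2 * y; y + z; 2 * z; x + z].

Definition on_conic (R : realType) (a : 'rV[R]_6) (p : 'rV[R]_3) : Prop :=
  min_attained_twice (fun j : 'I_6 => a 0 j + (monomials p)`_j).

Definition conic_matrix (R : realType) (P : 'I_4 -> 'rV[R]_3) : 'M[R]_(4, 6) :=
  \matrix_(i < 4, j < 6) (monomials (P i))`_j.

Definition generic (R : realType) (P : 'I_4 -> 'rV[R]_3) : Prop :=
  forall f : 'I_4 -> 'I_6, {homo f : i j / (i < j)%N} ->
    ~ trop_singular (colsub f (conic_matrix P)).

Definition pencil (R : realType) (P : 'I_4 -> 'rV[R]_3) : set 'rV[R]_6 :=
  [set a | forall i, on_conic a (P i)].

Definition realizable_by_pencil (R : realType) (G : ltree 6) : Prop :=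
  exists2 P : 'I_4 -> 'rV[R]_3, generic P &
  exists (T : ltree 6) (pos : T -> 'rV[R]_6),
    [/\ tropical_line pos, line_support pos = pencil P & ltree_iso T G].

(** * Embeddings in the unit disc *)

Definition unit_disc (R : realType) : set (R * R) :=
  [set p | p.1 ^+ 2 + p.2 ^+ 2 <= 1].

(* A plane drawing in the closed unit disc.  As every vertex is an end of some
   edge, the last clause also keeps vertices off the edges not incident to
   them. *)
Definition disc_embedding (R : realType) n (T : ltree n)
    (pt : T -> R * R) (arc : T -> T -> R -> R * R) : Prop :=
  [/\ injective pt,
      forall v, unit_disc (pt v),
      forall u v, adj u v ->
        [/\ {within `[0, 1], continuous (arc u v)},
            {in `[0, 1] &, injective (arc u v)},
            forall t : R, t \in `[0, 1] -> unit_disc (arc u v t),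
            arc u v 0 = pt u /\ arc u v 1 = pt v &
            forall t : R, t \in `[0, 1] -> arc v u t = arc u v (1 - t)] &
      forall u v u' v', adj u v -> adj u' v' -> ~ same_edge u v u' v' ->
        forall s t : R, s \in `[0, 1] -> t \in `[0, 1] ->
        arc u v s = arc u' v' t ->
        exists w, [/\ w = u \/ w = v, w = u' \/ w = v' & arc u v s = pt w]].

(* The leaves 0, ..., n-1 lie in this cyclic (counterclockwise) order on the
   unit circle; composing with a reflection gives the clockwise order. *)
Definition leaves_in_cyclic_order (R : realType) n (T : ltree n)
    (pt : T -> R * R) : Prop :=
  exists theta : 'I_n -> R,
    [/\ forall i, pt (leaf T i) = (cos (theta i), sin (theta i)),
        forall i j : 'I_n, (i < j)%N -> theta i < theta j &
        forall i j : 'I_n, theta j < theta i + 2 * pi].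

Definition planar_in_cyclic_order (R : realType) (G : ltree 6) : Prop :=
  exists (pt : G -> R * R) (arc : G -> G -> R -> R * R),
    disc_embedding pt arc /\ leaves_in_cyclic_order pt.

(* Main.v *)
From Stdlib Require Import ZArith.
Require Import Defs.
From mathcomp Require Import all_boot all_order all_algebra all_fingroup.
From mathcomp Require Import all_classical all_reals all_analysis.
From mathcomp Require Import zify ring lra.
From mathcomp Require Import ssrZ.

(* Both properties are equivalent to the absence of crossing splits: no edge
   separates leaves a, c from leaves b, d with a < b < c < d.

   If the pencil is a tropical line with a crossing split I | I^c, take a on the
   corresponding edge, which has the direction of the indicator of I, outside the
   finitely many places where some P_m has minimal monomials on both sides. Link two
   monomials when they are both minimal at the same P_m. Raising a on a connected
   component of this graph keeps it in the pencil; as the pencil is only the edge near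
   a, the components are I and I^c. The monomials lie in their cyclic order on the
   boundary of the Newton triangle, so some link in I crosses some link in I^c, which
   is impossible for edges of the regular subdivision defined by a.

   In a planar drawing a crossing split gives two disjoint paths in the disc whose ends
   alternate on the circle. After prolonging the paths along the two chords outside of
   the disc, the Poincare-Miranda theorem shows that they meet.

   Conversely, a trivalent tree without crossing splits, rooted at the leaf 0, is a
   plane binary tree with leaves 1, ..., 5. For each of these 14 trees a straight-line
   drawing and a configuration of four points are given and checked by computation; the
   inclusion of the pencil in the tropical line is a finite search over the pairs of
   minimal monomials of the four points, each case being a system of difference
   constraints. *)

Set Implicit Arguments.
Unset Strict Implicit.
Unset Printing Implicit Defensive.

Import Order.TTheory GRing.Theory Num.Theory.
Import numFieldNormedType.Exports.

(** * Leaf-labelled trees *)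

Section Branches.
Variables (n : nat) (T : ltree n).
Implicit Types u v w x y : T.

Definition off v : rel T := fun x y => [&& adj x y, x != v & y != v].

(** The component of [w] after deletion of [v]; for adjacent [v] and [w] this is the side of the
    edge that contains [w]. *)
Definition branch v w x : bool := connect (off v) w x.

Lemma adj_neq x y : adj x y -> x != y.
Proof. by apply: contraTneq => ->; rewrite adj_irr. Qed.

Lemma off_sym v : connect_sym (off v).
Proof.
by apply: sym_connect_sym => x y; rewrite /off adj_sym [(y != v) && _]andbC.
Qed.

Lemma path_off v x p :
  path (@adj _ T) x p -> v \notin x :: p -> path (off v) x p.
Proof.
elim: p x => //= y p IH x /andP[xy yp].
rewrite !inE !negb_or => /and3P[vx vy vp].
by rewrite /off xy eq_sym vx eq_sym vy IH // inE negb_or vy.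
Qed.

Lemma off_path v x p : path (off v) x p -> path (@adj _ T) x p.
Proof. by apply: sub_path => y z /and3P[]. Qed.

Lemma off_notin v x p : v != x -> path (off v) x p -> v \notin x :: p.
Proof.
elim: p x => [|y p IH] x vx; first by rewrite mem_seq1.
by case/andP=> /and3P[_ _ yv] yp; rewrite in_cons negb_or vx IH // eq_sym.
Qed.

(** Two distinct neighbours of [v] joined by a simple path avoiding [v] would close a cycle through
    [v]. *)
Lemma branch_uniq v w w' : adj v w -> adj v w' -> branch v w w' -> w = w'.
Proof.
move=> vw vw' /connectP[p0 pp0 e]; rewrite {}e in vw' *.
case/shortenP: pp0 vw' => p pp up _ vw'; apply/eqP; apply: contraT => ne.
case: p pp up vw' ne => [|y p] pp up vw' ne; first by rewrite eqxx in ne.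
exfalso; apply: (@adj_acyclic _ T [:: v, w, y & p]) => //.
rewrite /ucycle /path.cycle rcons_path /= vw; apply/andP; split.
  by apply/andP; split; [apply: (off_path pp) | rewrite adj_sym].
by rewrite -[X in is_true X]/((v \notin w :: y :: p) && uniq (w :: y :: p)) up
  (off_notin (adj_neq vw) pp).
Qed.

Lemma branch_refl v w : branch v w w. Proof. exact: connect0. Qed.

Lemma branch_notin v w : adj v w -> ~~ branch v w v.
Proof.
move=> vw; apply/negP => /connectP[p pp e].
have := off_notin (adj_neq vw) pp; by rewrite {1}e mem_last.
Qed.

(** A simple path from [w] to [x] either avoids [v], or its tail from [v] on avoids [w]. *)
Lemma branch_cover v w x : adj v w -> branch v w x || branch w v x.
Proof.
move=> vw; have /connectP[p0 pp0 ->] := adj_connected w x.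
case/shortenP: pp0 => p pp up _.
have [vp|vp] := boolP (v \in w :: p); last first.
  by apply/orP; left; apply/connectP; exists p => //; exact: path_off.
apply/orP; right; rewrite in_cons (negPf (adj_neq vw)) /= in vp.
case/splitPr: vp pp up => p1 p2; rewrite cat_path last_cat /= mem_cat => /and3P[_ _ pp] /andP[].
rewrite negb_or => /andP[_ wp] _.
by apply/connectP; exists p2 => //; exact: path_off.
Qed.

(** A simple path from [v] to [x] avoiding [w] starts with a neighbour [y] of [v], and [x] lies in
    the branch of [y]. If [x] also lay in the branch of [w], [branch_uniq] would give [y = w]. *)
Lemma branch_excl v w x : adj v w -> branch v w x -> ~~ branch w v x.
Proof.
move=> vw bx; apply/negP => /connectP[p0 pp0 ex].
rewrite {}ex in bx; case/shortenP: pp0 bx => -[|y p] /= pp up _ bx.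
  by rewrite (negPf (branch_notin vw)) in bx.
case/andP: pp => /and3P[vy _ yw] pp.
have : branch v y (last y p).
  apply/connectP; exists p => //; apply: path_off (off_path pp) _.
  by case/andP: up.
rewrite /branch off_sym => bx'.
have := branch_uniq vw vy (connect_trans bx bx') => e.
by rewrite e eqxx in yw.
Qed.

Lemma branchC v w x : adj v w -> branch w v x = ~~ branch v w x.
Proof.
move=> vw; have := branch_cover x vw; have := branch_excl (x := x) vw.
by case: (branch v w x) => /= [/(_ isT)/negPf|_ ->].
Qed.

Lemma branchS w v y x :
  adj w v -> adj w y -> y != v -> branch w y x -> branch v w x.
Proof.
move=> wv wy yv bx; rewrite branchC //; apply/negP => bx'.
rewrite /branch off_sym in bx.
by have := branch_uniq wv wy (connect_trans bx' bx) => e; rewrite e eqxx in yv.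
Qed.

Lemma branch_step v w x : adj v w -> branch v w x ->
  x = w \/ exists y, [/\ adj w y, y != v & branch w y x].
Proof.
move=> vw /connectP[p0 pp0 ->].
case/shortenP: pp0 => -[|y p] /= pp up _; [by left | right].
case/andP: pp => /and3P[wy _ yv] pp; exists y; split=> //.
apply/connectP; exists p => //; apply: path_off (off_path pp) _.
by case/andP: up.
Qed.

Lemma branch_disj w y y' x :
  adj w y -> adj w y' -> branch w y x -> branch w y' x -> y = y'.
Proof.
move=> wy wy' bx; rewrite /branch off_sym => bx'.
exact: branch_uniq (connect_trans bx bx').
Qed.

Lemma leaf_adj i v w : adj (leaf T i) v -> adj (leaf T i) w -> v = w.
Proof.
move=> av aw; have := leafP (leaf T i); rewrite codom_f => /esym/eqP c1.
have /eqP/card1P[x ex] := c1.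
have xP y : adj (leaf T i) y = (y == x) := ex y.
by rewrite !xP in av aw; rewrite (eqP av) (eqP aw).
Qed.

Lemma leaf_nbr i : exists v, adj (leaf T i) v.
Proof.
have := leafP (leaf T i); rewrite codom_f => /esym/eqP c1.
have /eqP/card1P[x ex] := c1; exists x.
by have -> : adj (leaf T i) x = (x == x) := ex x.
Qed.

Lemma branch_leaf v i x : adj v (leaf T i) -> branch v (leaf T i) x -> x = leaf T i.
Proof.
move=> vi /(branch_step vi)[//|[y [iy yv _]]].
by rewrite adj_sym in vi; rewrite (leaf_adj iy vi) eqxx in yv.
Qed.

Lemma innerP v : reflect (exists i, v = leaf T i) (~~ inner v).
Proof.
rewrite /inner negbK; apply: (iffP codomP) => -[i e]; by exists i.
Qed.

Lemma inner_leaf i : inner (leaf T i) = false.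
Proof. by rewrite /inner codom_f. Qed.

(** Both directions of the theorem pass through this property. Each edge occurs in both
    orientations, so it suffices to list the pattern with [a] and [c] on the side of [w]. *)
Definition noncrossing : Prop := forall v w, adj v w ->
  forall a b c d : 'I_n, (a < b)%N -> (b < c)%N -> (c < d)%N ->
  ~ [/\ branch v w (leaf T a), branch v w (leaf T c),
        branch w v (leaf T b) & branch w v (leaf T d)].

End Branches.

(** * Branches of a trivalent tree as rooted binary trees *)

Inductive bintree := Lf of nat | Nd of bintree & bintree.

Fixpoint word t : seq nat :=
  match t with Lf k => [:: k] | Nd t1 t2 => word t1 ++ word t2 end.

(* The branch of T from v through w is the binary tree t; vl lists its inner
   vertices in preorder. *)
Fixpoint rep n (T : ltree n) (v w : T) t (vl : seq T) : Prop :=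
  match t with
  | Lf k => exists i, [/\ w = leaf T i, k = val i & vl = [::]]
  | Nd t1 t2 => exists w1 w2 l1 l2,
      [/\ inner w, forall y, adj w y = (y \in [:: v; w1; w2]),
          uniq [:: v; w1; w2], vl = w :: l1 ++ l2 &
          rep w w1 t1 l1 /\ rep w w2 t2 l2]
  end.

(** The order of the two heads decides the order of the lists: an element violating it would lie
    between two elements of the other list, or have two elements of its own list around one of the
    other. *)
Lemma ltn_separated (z : nat) (s1 s2 : seq nat) :
  {in s1 & s2, forall x y, x != y} -> s1 != [::] -> s2 != [::] ->
  {in s1 ++ s2, forall x, z < x}%N ->
  (forall x y x', x \in s1 -> y \in s2 -> x' \in s1 -> (x < y)%N -> (y < x')%N -> False) ->
  (forall x y x', x \in s2 -> y \in s1 -> x' \in s2 -> (x < y)%N -> (y < x')%N -> False) ->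
  {in s1 & s2, forall x y, x < y}%N \/ {in s2 & s1, forall x y, x < y}%N.
Proof.
case: s1 s2 => [|a s1] [|b s2] // ne _ _ gt ex1 ex2.
have tot x y : x \in a :: s1 -> y \in b :: s2 -> (y < x)%N \/ (x < y)%N.
  by move=> xi yi; have := ne _ _ xi yi; rewrite neq_ltn => /orP[]; [right|left].
have ai : a \in a :: s1 by rewrite mem_head.
have bi : b \in b :: s2 by rewrite mem_head.
have [ba|ab] := tot a b ai bi; [right|left] => x y xi yi.
  have [//|yx] := tot _ _ yi xi.
  have [xa|ax] := tot _ _ ai xi; first by case: (ex1 y x a).
  by case: (ex2 b a x).
have [yx|//] := tot _ _ xi yi.
have [ya|ay] := tot _ _ ai yi; first by case: (ex2 y a b).
by case: (ex1 a y x).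
Qed.

Lemma word_neq0 t : word t != [::].
Proof. by elim: t => //= t1; case: (word t1). Qed.

Section Rep.
Variables (n : nat) (T : ltree n).
Implicit Types v w x y : T.

(** Descent away from [v]. The vertices [w :: v :: c] form the simple path already walked; as it has
    at most [#|T|] vertices, [m] bounds the remaining depth. *)
Lemma rep_exists v w : trivalent T -> adj v w -> exists t vl, rep v w t vl.
Proof.
move=> T3 vw.
suff: forall m c v w, uniq (w :: v :: c) -> path (@adj _ T) w (v :: c) ->
    (#|T| < size (w :: v :: c) + m)%N -> exists t vl, rep v w t vl.
  move=> H; apply: (H #|T| [::]).
  - by rewrite /= mem_seq1 eq_sym adj_neq.
  - by rewrite /= adj_sym vw.
  - by rewrite /= add2n ltnS leqW.
clear vw v w; elim=> [|m IH] c v w uc pc sc.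
  have := max_card (mem (w :: v :: c)); rewrite (card_uniqP uc) => /leq_ltn_trans.
  by move=> /(_ _ sc); rewrite addn0 ltnn.
have [iw|/innerP[i ->]] := boolP (inner w); last first.
  by exists (Lf i), [::]; exists i.
have wv : adj w v by case/andP: pc.
have pvc : path (@adj _ T) v c by case/andP: pc.
have vin : v \in enum (adj w) by rewrite mem_enum.
have := T3 w iw; rewrite cardE (perm_size (perm_to_rem vin)) /=.
have := perm_to_rem vin; have := enum_uniq (adj w).
case: (rem v _) => [|w1 [|w2 [|? ?]]] // eu pe _.
have u3 : uniq [:: v; w1; w2] by rewrite -(perm_uniq pe).
have nb y : adj w y = (y \in [:: v; w1; w2]).
  by rewrite -(perm_mem pe) mem_enum.
have child y : y \in [:: w1; w2] -> exists t vl, rep w y t vl.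
  move=> y12.
  have wy : adj w y by rewrite nb inE y12 orbT.
  have yv : y != v.
    by apply: contraTneq y12 => ->; case/andP: u3.
  apply: (IH (v :: c) w); last by move: sc; rewrite /= !addSn !addnS.
    rewrite cons_uniq uc andbT !in_cons !negb_or yv eq_sym adj_neq //=.
    apply/negP => yc.
    (* A child [y] on the walked path would be joined to [v] without passing through [w], hence
       equal to [v]. *)
    case/splitPr: yc uc pvc {pc sc} => c1 c2 uc.
    rewrite -cat_rcons cat_path => /andP[p1 _].
    have : branch w v y.
      apply/connectP; exists (rcons c1 y); last by rewrite last_rcons.
      apply: path_off p1 _; move: uc; rewrite cons_uniq -cat_rcons -cat_cons.
      by rewrite mem_cat negb_or => /andP[/andP[]].
    by move=> /(branch_uniq wv wy) e; rewrite e eqxx in yv.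
  by rewrite /= [adj y w]adj_sym wy wv pvc.
have [|t1 [l1 r1]] := child w1; first by rewrite !inE eqxx.
have [|t2 [l2 r2]] := child w2; first by rewrite !inE eqxx orbT.
by exists (Nd t1 t2), (w :: l1 ++ l2), w1, w2, l1, l2.
Qed.

Section Node.
Variables v w w1 w2 : T.
Hypothesis vw : adj v w.
Hypothesis nb : forall y, adj w y = (y \in [:: v; w1; w2]).
Hypothesis u3 : uniq [:: v; w1; w2].

Lemma node_adj1 : adj w w1. Proof. by rewrite nb !inE eqxx orbT. Qed.
Lemma node_adj2 : adj w w2. Proof. by rewrite nb !inE eqxx !orbT. Qed.

Lemma node_neq : [/\ w1 != v, w2 != v & w1 != w2].
Proof.
by move: u3; rewrite /= !inE negb_or -andbA ![v == _]eq_sym => /and4P[].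
Qed.

Lemma branch_node x : branch v w x = [|| x == w, branch w w1 x | branch w w2 x].
Proof.
have [n1 n2 _] := node_neq; have wv : adj w v by rewrite adj_sym.
apply/idP/or3P => [/(branch_step vw)[->|[y [wy yv yx]]]|[/eqP->|b|b]].
- exact: Or31.
- move: wy; rewrite nb !inE (negPf yv) /= => /orP[]/eqP e; rewrite e in yx.
    exact: Or32.
  exact: Or33.
- exact: branch_refl.
- exact: branchS wv node_adj1 n1 b.
- exact: branchS wv node_adj2 n2 b.
Qed.

Lemma node_disj x : branch w w1 x -> branch w w2 x -> False.
Proof.
move=> b1 b2; have := branch_disj node_adj1 node_adj2 b1 b2 => e.
by have [_ _] := node_neq; rewrite e eqxx.
Qed.

End Node.

Lemma rep_word v w t vl i : adj v w -> rep v w t vl ->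
  (val i \in word t) = branch v w (leaf T i).
Proof.
elim: t v w vl => [k|t1 IH1 t2 IH2] v w vl vw.
  case=> j [ew -> _]; rewrite /= mem_seq1.
  apply/eqP/idP => [/val_inj->|]; first by rewrite -ew branch_refl.
  by rewrite ew in vw *; move/(branch_leaf vw)/leaf_inj->.
case=> w1 [w2 [l1 [l2 [iw nb u3 _ [r1 r2]]]]].
rewrite /= mem_cat (branch_node vw nb u3) (IH1 _ _ _ _ r1) ?(node_adj1 nb) //.
rewrite (IH2 _ _ _ _ r2) ?(node_adj2 nb) //.
by case: eqP => // e; move: iw; rewrite -e inner_leaf.
Qed.

Lemma rep_word_lt v w t vl k : rep v w t vl -> k \in word t -> (k < n)%N.
Proof.
elim: t v w vl => [k'|t1 IH1 t2 IH2] v w vl /=.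
  by case=> i [_ -> _]; rewrite mem_seq1 => /eqP->.
case=> w1 [w2 [l1 [l2 [_ _ _ _ [r1 r2]]]]].
by rewrite mem_cat => /orP[]; [apply: IH1 r1 | apply: IH2 r2].
Qed.

Lemma rep_inner v w t vl : adj v w -> rep v w t vl ->
  uniq vl /\ forall x, (x \in vl) = inner x && branch v w x.
Proof.
elim: t v w vl => [k|t1 IH1 t2 IH2] v w vl vw.
  case=> j [ew _ ->]; rewrite ew in vw *; split=> // x; rewrite in_nil.
  by apply/esym/negP => /andP[+ /(branch_leaf vw) e]; rewrite e inner_leaf.
case=> w1 [w2 [l1 [l2 [iw nb u3 -> [r1 r2]]]]].
have [ul1 m1] := IH1 _ _ _ (node_adj1 nb) r1.
have [ul2 m2] := IH2 _ _ _ (node_adj2 nb) r2.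
split=> [|x].
  rewrite /= cat_uniq ul1 ul2 mem_cat m1 m2 iw /= andbT.
  rewrite negb_or !branch_notin ?(node_adj1 nb) ?(node_adj2 nb) //=.
  apply/hasPn => x; rewrite /= m1 m2 => /andP[_ b2]; apply/negP => /andP[_ b1].
  exact: node_disj b1 b2.
rewrite in_cons mem_cat m1 m2 (branch_node vw nb u3).
by case: eqP => [->|_] /=; rewrite ?iw // andb_orr.
Qed.

(** The leaf 0 lies outside of the branch and below all its labels. If [p < q < r] with [p], [r]
    below one child and [q] below the other, then 0, [q] against [p], [r] is a crossing split. Hence
    the words of the two children are separated, and exchanging the children if necessary sorts the
    word. *)
Lemma rep_sorted (z : 'I_n) v w t vl : noncrossing T -> val z = 0%N ->
  adj v w -> branch w v (leaf T z) -> rep v w t vl ->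
  exists t' vl', rep v w t' vl' /\ sorted ltn (word t').
Proof.
move=> nc z0; elim: t v w vl => [k|t1 IH1 t2 IH2] v w vl vw zv.
  by move=> r; exists (Lf k), vl.
case=> w1 [w2 [l1 [l2 [iw nb u3 _ [r1 r2]]]]].
have a1 := node_adj1 nb; have a2 := node_adj2 nb.
have zw : ~~ branch v w (leaf T z) by rewrite -branchC.
have := zw; rewrite (branch_node vw nb u3) !negb_or => /and3P[_].
rewrite -!branchC // => z1 z2.
have [s1 [k1 [{}r1 so1]]] := IH1 _ _ _ a1 z1 r1.
have [s2 [k2 [{}r2 so2]]] := IH2 _ _ _ a2 z2 r2.
have cross y y' s k : adj w y -> adj w y' -> y != y' ->
    branch y w (leaf T z) ->
    rep w y s k -> forall s' k', rep w y' s' k' ->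
    forall p q r, p \in word s -> q \in word s' -> r \in word s ->
      (p < q)%N -> (q < r)%N -> False.
  move=> wy wy' yy' zy ry s' k' ry' p q r pin qin rin pq qr.
  have e i := rep_word i wy ry.
  have e' i := rep_word i wy' ry'.
  have pn := rep_word_lt ry pin; have qn := rep_word_lt ry' qin.
  have rn := rep_word_lt ry rin.
  have zp : (z < Ordinal pn)%N.
    rewrite z0 lt0n /=; apply: contraTneq pin => p0.
    by rewrite p0 -z0 e -branchC.
  apply: (nc _ _ _ z (Ordinal pn) (Ordinal qn) (Ordinal rn) zp pq qr).
    by rewrite adj_sym; exact: wy.
  split=> //; rewrite -?e // branchC //; apply/negP => bq.
  move: qin; rewrite -[q]/(val (Ordinal qn)) e' => bq'.
  by have := branch_disj wy wy' bq bq' => yye; rewrite yye eqxx in yy'.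
have [_ _ n12] := node_neq u3.
have n21 : w2 != w1 by rewrite eq_sym.
have [||||||lt12|lt21] := @ltn_separated 0 (word s1) (word s2).
- move=> x y xin yin; apply/eqP => xy; rewrite -xy in yin.
  have xn := rep_word_lt r1 xin.
  move: xin yin; rewrite -[x]/(val (Ordinal xn)).
  by rewrite (rep_word _ a1 r1) (rep_word _ a2 r2); exact: node_disj.
- exact: word_neq0.
- exact: word_neq0.
- move=> x; rewrite lt0n mem_cat => xin; apply: contraTneq xin => ->.
  rewrite -z0 (rep_word _ a1 r1) (rep_word _ a2 r2).
  by rewrite negb_or -!branchC // z1 z2.
- exact: cross r1 _ _ r2.
- exact: cross r2 _ _ r1.
- exists (Nd s1 s2), (w :: k1 ++ k2); split; first by exists w1, w2, k1, k2.
  move: so1 so2; rewrite /= !(sorted_pairwise ltn_trans) pairwise_cat => -> ->.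
  by rewrite !andbT; apply/allrelP => x y xi yi; exact: lt12.
- exists (Nd s2 s1), (w :: k2 ++ k1); split.
    exists w2, w1, k2, k1; split=> //.
      by move=> y; rewrite nb !inE [(y == w1) || _]orbC.
    by rewrite -(perm_uniq (_ : perm_eq [:: v; w1; w2] _)) // perm_cons
      (perm_catC [:: w1] [:: w2]).
  move: so1 so2; rewrite /= !(sorted_pairwise ltn_trans) pairwise_cat => -> ->.
  by rewrite !andbT; apply/allrelP => x y xi yi; exact: lt21.
Qed.

End Rep.

(** * Enumeration of the plane binary trees with a given word *)

Fixpoint plane_trees m (l : seq nat) : seq bintree :=
  if m is m'.+1 then
    if l is [:: k] then [:: Lf k] else
    flatten [seq [seq Nd t1 t2 | t1 <- plane_trees m' (take i l),
                                 t2 <- plane_trees m' (drop i l)]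
            | i <- iota 1 (size l).-1]
  else [::].

Lemma all_flatten (A : Type) (P : pred A) ss : all P (flatten ss) = all (all P) ss.
Proof. by elim: ss => //= s ss IH; rewrite all_cat IH. Qed.

(** Transfers a check on the finite list to every tree with this word; [m] is the fuel of the
    enumeration. The predicate varies in the induction: for the left subtree it is the check over
    all right subtrees. *)
Lemma all_plane_trees m l (P : pred bintree) t :
  all P (plane_trees m l) -> word t = l -> (size l <= m)%N -> P t.
Proof.
move=> H e; rewrite -{}e {l} in H *; elim: m t P H => [|m IH] t P.
  by case: (word t) (word_neq0 t).
case: t => [k|t1 t2]; first by case/andP.
have [n1 n2] : (0 < size (word t1))%N /\ (0 < size (word t2))%N.
  by rewrite !lt0n !size_eq0 !word_neq0.
have e l : (1 < size l)%N -> plane_trees m.+1 l =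
    flatten [seq [seq Nd t1 t2 | t1 <- plane_trees m (take i l),
                                 t2 <- plane_trees m (drop i l)]
            | i <- iota 1 (size l).-1] by case: l => [|x [|y s]].
have w2 : (1 < size (word (Nd t1 t2)))%N by rewrite /= size_cat; lia.
rewrite {}e {w2}//.
rewrite all_flatten all_map => /allP/(_ (size (word t1))).
rewrite mem_iota /= !size_cat => H sz.
have {}H := H ltac:(lia).
move: H; rewrite take_size_cat // drop_size_cat // all_flatten all_map.
move=> /IH H1; have {H1} := H1 ltac:(lia).
by rewrite /= all_map => /IH; apply; lia.
Qed.

(** * Numbering of the vertices *)

Fixpoint inner_count t :=
  if t is Nd t1 t2 then (inner_count t1 + inner_count t2).+1 else 0%N.

(* The edges of the rooted tree t hanging from the vertex numbered p, when the
   leaf k has number k and the inner vertices are numbered in preorder from b. *)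
Fixpoint edges (p b : nat) t : seq (nat * nat) :=
  match t with
  | Lf k => [:: (p, k)]
  | Nd t1 t2 =>
    (p, b) :: edges b b.+1 t1 ++ edges b (b.+1 + inner_count t1) t2
  end.

Section Numbering.
Variables (n : nat) (T : ltree n).
Implicit Types v w x y : T.

Lemma rep_size v w t vl : rep v w t vl -> size vl = inner_count t.
Proof.
elim: t v w vl => [k|t1 IH1 t2 IH2] v w vl /=; first by case=> i [_ _ ->].
case=> w1 [w2 [l1 [l2 [_ _ _ -> [r1 r2]]]]] /=.
by rewrite size_cat (IH1 _ _ _ r1) (IH2 _ _ _ r2).
Qed.

Variables (x0 : T) (vs : seq T).
Hypothesis vs_leaf : forall i : 'I_n, nth x0 vs i = leaf T i.
Local Notation V := (nth x0 vs).

(** The hypothesis on [drop b vs] says that the inner vertices of the branch carry the numbers from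
    [b] on, in preorder, as [edges] presupposes. The second part covers every edge with an end in
    the branch, including the root edge to [v]. *)
Lemma rep_edges v w t vl p b s : adj v w -> rep v w t vl -> V p = v ->
  drop b vs = vl ++ s ->
  (forall j k, (j, k) \in edges p b t -> adj (V j) (V k)) /\
  (forall x y, branch v w x -> adj x y -> exists j k,
     (j, k) \in edges p b t /\ (x = V j /\ y = V k \/ x = V k /\ y = V j)).
Proof.
elim: t v w vl p b s => [k|t1 IH1 t2 IH2] v w vl p b s vw.
  case=> i [ew -> _] Vp _; rewrite ew in vw *; split=> [j k'|x y].
    by rewrite mem_seq1 => /eqP[-> ->]; rewrite Vp vs_leaf.
  move=> /(branch_leaf vw) -> iy; exists p, (val i); rewrite mem_head; split=> //.
  rewrite adj_sym in vw; right.
  by rewrite vs_leaf Vp (leaf_adj iy vw).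
case=> w1 [w2 [l1 [l2 [iw nb u3 -> [r1 r2]]]]] Vp dr.
have a1 := node_adj1 nb; have a2 := node_adj2 nb.
have Vb : V b = w by rewrite -[b]addn0 -nth_drop dr.
have dr1 : drop b.+1 vs = l1 ++ (l2 ++ s).
  by rewrite -add1n -drop_drop dr /= drop0 catA.
have dr2 : drop (b.+1 + inner_count t1) vs = l2 ++ s.
  by rewrite addnC -drop_drop dr1 drop_size_cat // (rep_size r1).
have [so1 co1] := IH1 _ _ _ _ _ _ a1 r1 Vb dr1.
have [so2 co2] := IH2 _ _ _ _ _ _ a2 r2 Vb dr2.
have root1 : exists j k, (j, k) \in edges b b.+1 t1 /\ V j = w /\ V k = w1.
  case: (t1) r1 dr1 => [k [i [-> -> _]] _|s1 s2 /=].
    by exists b, (val i); rewrite mem_head vs_leaf.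
  case=> ? [? [? [? [_ _ _ -> _]]]] dr'; exists b, b.+1; rewrite mem_head.
  by split=> //; split=> //; rewrite -[b.+1]addn0 -nth_drop dr'.
have root2 : exists j k,
    (j, k) \in edges b (b.+1 + inner_count t1) t2 /\ V j = w /\ V k = w2.
  case: (t2) r2 dr2 => [k [i [-> -> _]] _|s1 s2 /=].
    by exists b, (val i); rewrite mem_head vs_leaf.
  case=> ? [? [? [? [_ _ _ -> _]]]] dr'.
  exists b, (b.+1 + inner_count t1)%N; rewrite mem_head.
  by split=> //; split=> //; rewrite -[(_ + inner_count t1)%N]addn0 -nth_drop dr'.
split=> [j k|x y].
  rewrite /= in_cons mem_cat => /orP[/eqP[-> ->]|/orP[/so1|/so2]//].
  by rewrite Vp Vb.
rewrite (branch_node vw nb u3) => /or3P[/eqP->|b1|b2] xy.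
- move: xy; rewrite nb !inE => /or3P[]/eqP->.
  + by exists p, b; rewrite mem_head; split=> //; right.
  + have [j [k [jk [<- <-]]]] := root1.
    by exists j, k; rewrite in_cons mem_cat jk orbT; split=> //; left.
  + have [j [k [jk [<- <-]]]] := root2.
    by exists j, k; rewrite in_cons mem_cat jk !orbT; split=> //; left.
- have [j [k [jk e]]] := co1 _ _ b1 xy.
  by exists j, k; rewrite in_cons mem_cat jk orbT.
- have [j [k [jk e]]] := co2 _ _ b2 xy.
  by exists j, k; rewrite in_cons mem_cat jk !orbT.
Qed.

End Numbering.

Definition tree_edge (t : bintree) (j k : nat) : bool :=
  let E := edges 0 6 t in ((j, k) \in E) || ((k, j) \in E).

(** A trivalent tree with six leaves has four inner vertices: the numbers 0 to 5 are the leaf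
    labels, 6 to 9 the inner vertices. *)
Definition numbering (T : ltree 6) (t : bintree) (x0 : T) (vs : seq T) : Prop :=
  [/\ uniq vs, size vs = 10%N, forall x, x \in vs,
      forall i : 'I_6, nth x0 vs i = leaf T i &
      forall j k, (j < 10)%N -> (k < 10)%N ->
        adj (nth x0 vs j) (nth x0 vs k) = tree_edge t j k].

Lemma inner_count_word t : size (word t) = (inner_count t).+1.
Proof. by elim: t => //= t1 IH1 t2 IH2; rewrite size_cat IH1 IH2 addSn addnS. Qed.

(** The tree is rooted at the leaf 0. The word of the branch behind it is strictly increasing and
    consists of the other five labels, so it is 1, ..., 5. *)
Lemma noncrossing_numbering (T : ltree 6) : trivalent T -> noncrossing T ->
  exists t x0 vs, word t = iota 1 5 /\ @numbering T t x0 vs.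
Proof.
move=> T3 nc; pose z : 'I_6 := ord0.
have [w0 zw] := leaf_nbr T z.
have wz : adj w0 (leaf T z) by rewrite adj_sym.
have bz : branch w0 (leaf T z) (leaf T z) by exact: branch_refl.
have [t0 [vl0 r0]] := rep_exists T3 zw.
have [t [vl [r so]]] := rep_sorted nc (erefl : val z = 0%N) zw bz r0.
have inz x : x != leaf T z -> branch (leaf T z) w0 x.
  by apply: contraNT; rewrite -branchC // => /(branch_leaf wz)->.
have wt : word t = iota 1 5.
  apply: (irr_sorted_eq ltn_trans ltnn so) => // k.
  rewrite mem_iota; have [k6|k6] := ltnP k 6; last first.
    rewrite andbF; apply/negP => /(rep_word_lt r); lia.
  rewrite -[k]/(val (Ordinal k6)) (rep_word _ zw r) andbT /=.
  case: k k6 => [|k] k6.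
    have -> : Ordinal k6 = z by exact: val_inj.
    by rewrite (negPf (branch_notin zw)).
  by apply: inz; apply/eqP => /leaf_inj.
have [uvl mvl] := rep_inner zw r.
exists t, (leaf T z), ([seq leaf T i | i <- enum 'I_6] ++ vl); split=> //.
have vl4 : size vl = 4%N.
  by have := inner_count_word t; rewrite wt (rep_size r) => -[].
set vs := _ ++ _.
have uvs : uniq vs.
  rewrite cat_uniq uvl andbT (map_inj_uniq (@leaf_inj _ T)) enum_uniq /=.
  apply/hasPn => x; rewrite mvl => /andP[+ _].
  by apply: contraTN => /mapP[i _ ->]; rewrite inner_leaf.
have svs : size vs = 10%N by rewrite size_cat size_map size_enum_ord vl4.
have invs x : x \in vs.
  rewrite mem_cat; have [ix|/innerP[i ->]] := boolP (inner x); last first.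
    by rewrite map_f // mem_enum.
  rewrite mvl ix inz ?orbT //.
  by apply: contraTneq ix => ->; rewrite inner_leaf.
have lvs (i : 'I_6) : nth (leaf T z) vs i = leaf T i.
  rewrite nth_cat size_map size_enum_ord ltn_ord.
  by rewrite (nth_map z) ?size_enum_ord // nth_ord_enum.
split=> // j k j10 k10; rewrite -svs in j10 k10.
have dr : drop 6 vs = vl ++ [::].
  by rewrite cats0 drop_size_cat // size_map size_enum_ord.
have [so1 co1] := rep_edges lvs zw r (lvs z) dr.
have nthE i i' : (i < size vs)%N -> (i' < size vs)%N ->
    nth (leaf T z) vs i = nth (leaf T z) vs i' -> i = i'.
  by move=> ? ? /eqP; rewrite nth_uniq // => /eqP.
apply/idP/orP => [jk|[/so1//|/so1]]; last by rewrite adj_sym.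
(* Every edge has an end in the branch behind the leaf 0; if the first end is that leaf, the second
   one is used. *)
have [j' [k' [e V]]] : exists j' k', (j', k') \in edges 0 6 t /\
    (nth (leaf T z) vs j = nth (leaf T z) vs j' /\
     nth (leaf T z) vs k = nth (leaf T z) vs k' \/
     nth (leaf T z) vs j = nth (leaf T z) vs k' /\
     nth (leaf T z) vs k = nth (leaf T z) vs j').
  have [ej|/inz bj] := eqVneq (nth (leaf T z) vs j) (leaf T z).
    rewrite ej in jk *.
    have bk : branch (leaf T z) w0 (nth (leaf T z) vs k).
      by apply: inz; rewrite eq_sym adj_neq.
    rewrite adj_sym in jk.
    have [j' [k' [e V]]] := co1 _ _ bk jk; exists j', k'; split=> //.
    by case: V => -[e1 e2]; [right|left].
  exact: co1 bj jk.
(* Beyond the size of [vs], [nth] returns its default, so the numbers in [edges] are bounded first,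
   by inspection of all trees with this word. *)
have lt10 : (j' < size vs)%N /\ (k' < size vs)%N.
  rewrite svs; have /allP : all (fun e => (e.1 < 10) && (e.2 < 10))%N (edges 0 6 t).
    apply: (all_plane_trees (m := 5) (l := iota 1 5)
      (P := fun t => all (fun e => (e.1 < 10) && (e.2 < 10))%N (edges 0 6 t))) => //.
  by move=> /(_ _ e) /andP[].
have [j10' k10'] := lt10.
by case: V => -[/nthE -> // /nthE -> //]; [left|right].
Qed.

(** * Crossing paths in the disc *)

Section GridParity.
Variables (N : nat) (a b : nat -> nat -> bool).

(* A winding number modulo 2: if on each unit square a or b is constant, the changes
   of a at which b holds cancel around each unit square. *)
Fixpoint row_parity (k j : nat) : bool :=
  if k is i.+1 then row_parity i j (+) ((a i j (+) a i.+1 j) && b i j) else false.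

Lemma grid_parity :
  (forall i j, (i < N)%N -> (j < N)%N ->
     [&& a i.+1 j == a i j, a i j.+1 == a i j & a i.+1 j.+1 == a i j] ||
     [&& b i.+1 j == b i j, b i j.+1 == b i j & b i.+1 j.+1 == b i j]) ->
  (forall j, (j <= N)%N -> a 0%N j = false /\ a N j = true) ->
  (forall i, (i <= N)%N -> b i 0%N = false /\ b i N = true) -> False.
Proof.
move=> cell ha hb.
(* Summation over the unit squares between two rows leaves the changes along the two vertical sides;
   for [k = N] these vanish, since [a] is constant there. *)
have rows k j : (k <= N)%N -> (j < N)%N ->
    row_parity k j (+) row_parity k j.+1 =
    ((a 0 j (+) a 0 j.+1) && b 0 j) (+) ((a k j (+) a k j.+1) && b k j).
  move=> + jN; elim: k => [|k IH] kN /=; first by rewrite addbb.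
  move: (IH (ltnW kN)) (cell k j kN jN).
  case: (row_parity k j); case: (row_parity k j.+1); case: (_ && b 0 j);
  case: (a k j); case: (a k j.+1); case: (a k.+1 j); case: (a k.+1 j.+1);
  by case: (b k j); case: (b k j.+1); case: (b k.+1 j); case: (b k.+1 j.+1).
have const j : (j <= N)%N -> row_parity N j = row_parity N 0.
  elim: j => // j IH jN; rewrite -IH ?(ltnW jN) //.
  have := rows N j (leqnn N) jN.
  have [-> ->] := ha _ (ltnW jN); have [-> ->] := ha _ jN => /=.
  by case: (row_parity N j); case: (row_parity N j.+1).
have bot k : (k <= N)%N -> row_parity k 0 = false.
  elim: k => //= k IH kN; rewrite IH ?(ltnW kN) //.
  by have [-> _] := hb _ (ltnW kN); rewrite andbF.
have top k : (k <= N)%N -> row_parity k N = a 0 N (+) a k N.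
  elim: k => [|k IH] kN /=; first by rewrite addbb.
  rewrite IH ?(ltnW kN) //; have [_ ->] := hb _ (ltnW kN).
  by rewrite andbT addbA addbK.
have := const N (leqnn N); rewrite bot // top //.
by have [-> ->] := ha _ (leqnn N).
Qed.

End GridParity.

Local Open Scope classical_set_scope.
Local Open Scope ring_scope.

(** * The Poincare-Miranda theorem and paths in the disc *)

Section PlanePaths.
Variable R : realType.
Implicit Types (s t : R) (p q : R * R -> R) (A B C D : R * R).

Lemma sign_locally_constant p (x : R * R) : {for x, continuous p} -> p x != 0 ->
  exists2 e : R, 0 < e & forall y z, ball x e y -> ball x e z -> (0 < p y) = (0 < p z).
Proof.
move=> cp; rewrite neq_lt => /orP[] px.
  have /nbhs_ballP[e e0 he] : \forall y \near x, p y < 0.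
    by apply: (cp [set r | r < 0]); exact: lt_nbhsl.
  exists e => // y z /he /= py /he /= pz.
  by rewrite !ltNge (ltW py) (ltW pz).
have /nbhs_ballP[e e0 he] : \forall y \near x, 0 < p y.
  by apply: (cp [set r | 0 < r]); exact: lt_nbhsr.
by exists e => // y z /he /= py /he /= pz; rewrite py pz.
Qed.

(* The Poincare-Miranda theorem for the square. *)
Lemma square_zero p q : continuous p -> continuous q ->
  (forall t, 0 <= t <= 1 -> p (0, t) < 0 /\ 0 < p (1, t)) ->
  (forall s, 0 <= s <= 1 -> q (s, 0) < 0 /\ 0 < q (s, 1)) ->
  exists s t, [/\ 0 <= s <= 1, 0 <= t <= 1, p (s, t) = 0 & q (s, t) = 0].
Proof.
move=> cp cq hp hq; apply: contrapT => no.
have no0 s t : 0 <= s <= 1 -> 0 <= t <= 1 -> p (s, t) != 0 \/ q (s, t) != 0.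
  move=> s01 t01; have [p0|] := eqVneq (p (s, t)) 0; last by left.
  right; apply/eqP => q0; apply: no; by exists s, t.
pose small e (x : R * R) :=
  (forall y, ball x e y -> (0 < p y) = (0 < p x)) \/
  (forall y, ball x e y -> (0 < q y) = (0 < q x)).
have sq : compact (`[0 : R, 1] `*` `[0 : R, 1]).
  by apply: compact_setX; exact: segment_compact.
(* Compactness makes the radius uniform: around each point of the square, one of the two signs is
   constant on the ball of radius [e]. *)
have : \forall e \near (0 : R)^'+,
    `[0 : R, 1] `*` `[0 : R, 1] `<=` small e.
  move/compact_near_coveringP : sq; apply => -[s t] [/= s01 t01].
  have [e e0 he] : exists2 e : R, 0 < e &
      (forall y z, ball (s, t) e y -> ball (s, t) e z -> (0 < p y) = (0 < p z)) \/
      (forall y z, ball (s, t) e y -> ball (s, t) e z -> (0 < q y) = (0 < q z)).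
    rewrite !in_itv /= in s01 t01; have [nz|nz] := no0 s t s01 t01.
      by have [e e0 he] := sign_locally_constant (cp _) nz; exists e => //; left.
    by have [e e0 he] := sign_locally_constant (cq _) nz; exists e => //; right.
  have e20 : 0 < e / 2 by rewrite divr_gt0.
  exists (ball (s, t) (e / 2), [set r | r < e / 2]).
    split; first exact: nbhsx_ballx.
    exact: nbhs_right_lt.
  move=> [x r] [/= bx re].
  have big y : ball x r y -> ball (s, t) e y.
    by move=> bxy; apply: ball_split bx _; apply: le_ball bxy; exact: ltW.
  have bx' : ball (s, t) e x by apply: le_ball bx; lra.
  by case: he => he; [left|right] => y /big by'; apply: he.
move=> /(filterI (nbhs_right_gt 0)) /filter_ex[e [/= e0 sm]].
(* With mesh below [e], each grid square lies in the ball around its lower left corner, as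
   [grid_parity] requires. *)
have [m me] : exists m, (m.+1%:R : R)^-1 < e.
  by exists (Num.truncn e^-1); rewrite invf_plt ?posrE // truncnS_gt.
pose x (i : nat) : R := i%:R / m.+1%:R.
have x01 i : (i <= m.+1)%N -> 0 <= x i <= 1.
  by move=> im; rewrite divr_ge0 //= ler_pdivrMr // mul1r ler_nat.
have xS i : x i.+1 = x i + m.+1%:R^-1.
  by rewrite /x -addn1 natrD mulrDl mul1r.
have x0 : x 0%N = 0 by rewrite /x mul0r.
have x1 : x m.+1 = 1 by rewrite /x divff.
have near1 i : ball (x i) e (x i.+1).
  by rewrite /ball /= xS opprD addNKr normrN gtr0_norm.
apply: (@grid_parity m.+1 (fun i j => 0 < p (x i, x j))
   (fun i j => 0 < q (x i, x j))).
- move=> i j im jm.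
  have inx : (`[0 : R, 1] `*` `[0 : R, 1]) (x i, x j).
    by split; rewrite /= in_itv /= x01 // ltnW.
  have near0 k : ball (x k) e (x k) by exact: ballxx.
  by have [h|h] := sm _ inx; rewrite !h ?eqxx ?orbT //; split => /=.
- move=> j jm; rewrite x0 x1; have [h1 h2] := hp _ (x01 _ jm).
  by rewrite h2 ltNge (ltW h1).
- move=> i im; rewrite x0 x1; have [h1 h2] := hq _ (x01 _ im).
  by rewrite h2 ltNge (ltW h1).
Qed.


Definition joined (X : set (R * R)) A B := exists f : R -> R * R,
  [/\ continuous f, f 0 = A, f 1 = B & forall s, 0 <= s <= 1 -> X (f s)].

(** The retraction of the line onto the unit interval; composition with it makes a path on the
    interval continuous on the whole line. *)
Definition clamp s : R := Num.max 0 (Num.min s 1).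

Lemma clamp01 s : 0 <= clamp s <= 1.
Proof. by rewrite le_max lexx /= ge_max ler01 ge_min lexx orbT. Qed.

Lemma clamp_id s : 0 <= s <= 1 -> clamp s = s.
Proof.
by move=> /andP[s0 s1]; rewrite /clamp (min_idPl s1) (max_idPr s0).
Qed.

Lemma clamp_neg s : s <= 0 -> clamp s = 0.
Proof. by move=> s0; rewrite /clamp (min_idPl (le_trans s0 ler01)) (max_idPl s0). Qed.

Lemma clamp_big s : 1 <= s -> clamp s = 1.
Proof. by move=> s0; rewrite /clamp (min_idPr s0) (max_idPr ler01). Qed.

Lemma clamp_continuous : continuous clamp.
Proof.
move=> s.
apply: (@continuous_max R R (cst 0 : R -> R^o) (id \min cst (1 : R^o)) s).
  exact: cst_continuous.
by apply: continuous_min; [exact: cvg_id | exact: cst_continuous].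
Qed.

Lemma joined_arc X (c : R -> R * R) : {within `[0, 1], continuous c} ->
  (forall s, s \in `[0, 1] -> X (c s)) -> joined X (c 0) (c 1).
Proof.
move=> cc cX; exists (c \o clamp); split => /=.
- move=> s; have s01 : `[0, 1]%classic (clamp s) by rewrite /= in_itv /= clamp01.
  move/subspace_continuousP: cc => /(_ _ s01) cc.
  apply: cvg_comp cc => P wP.
  have h : \forall z \near s, `[0, 1]%classic (clamp z) -> P (clamp z).
    exact: (clamp_continuous (wP : nbhs (clamp s) (fun z => `[0, 1]%classic z -> P z))).
  by apply: filterS h => z /=; apply; rewrite in_itv /= clamp01.
- by rewrite clamp_neg.
- by rewrite clamp_big.
- by move=> s s01; apply: cX; rewrite in_itv /= clamp01.
Qed.

(* Concatenation without a case distinction: the first path stands still at its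
   end while the second one moves, and conversely. *)
Lemma joined_trans X A B C : joined X A B -> joined X B C -> joined X A C.
Proof.
move=> [f [cf f0 f1 fX]] [g [cg g0 g1 gX]].
exists (fun s => f (clamp (2 * s)) + g (clamp (2 * s - 1)) - B); split.
- move=> s; apply: cvgB; last exact: cvg_cst.
  have c2 : {for s, continuous (fun s : R => 2 * s)}.
    by apply: cvgM; [exact: cvg_cst | exact: cvg_id].
  apply: cvgD.
    apply: (@continuous_comp _ _ _ (clamp \o (fun s : R => 2 * s)) f); last exact: cf.
    by apply: continuous_comp => //; exact: clamp_continuous.
  apply: (@continuous_comp _ _ _ (clamp \o (fun s : R => 2 * s - 1)) g); last exact: cg.
  apply: continuous_comp; last exact: clamp_continuous.
  by apply: cvgB => //; exact: cvg_cst.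
- by rewrite !clamp_neg ?f0 ?g0 ?addrK //; lra.
- by rewrite !clamp_big ?f1 ?g1 1?addrC ?addrA ?addNr ?add0r //; lra.
- move=> s /andP[s0 s1]; have [h|h] := leP (2 * s) 1.
    by rewrite (@clamp_neg (2 * s - 1)) ?g0 ?addrK ?subr_le0 //; exact/fX/clamp01.
  rewrite (@clamp_big (2 * s)) ?f1; last exact: ltW.
  by rewrite addrAC subrr add0r; exact/gX/clamp01.
Qed.

(** Twice the signed area of the triangle ABC, positive for a counterclockwise triangle. *)
Definition cross A B C : R := (B.1 - A.1) * (C.2 - A.2) - (B.2 - A.2) * (C.1 - A.1).

(** [cross D B] and [cross A C] are affine coordinates of the plane. Prolonging the first path along
    AC changes only the former, prolonging the second along BD only the latter. Hence the
    differences of these coordinates have opposite signs on opposite sides of a large parameter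
    square, and [square_zero] applies. *)
Lemma disc_paths_meet (f g : R -> R * R) A B C D :
  continuous f -> continuous g ->
  (forall s, 0 <= s <= 1 -> unit_disc (f s)) ->
  (forall s, 0 <= s <= 1 -> unit_disc (g s)) ->
  f 0 = A -> f 1 = C -> g 0 = B -> g 1 = D ->
  A.1 ^+ 2 + A.2 ^+ 2 = 1 -> B.1 ^+ 2 + B.2 ^+ 2 = 1 ->
  C.1 ^+ 2 + C.2 ^+ 2 = 1 -> D.1 ^+ 2 + D.2 ^+ 2 = 1 ->
  cross D B A < 0 -> 0 < cross D B C -> cross A C B < 0 -> 0 < cross A C D ->
  exists s t, [/\ 0 <= s <= 1, 0 <= t <= 1 & f s = g t].
Proof.
move=> cf cg df dg f0 f1 g0 g1 nA nB nC nD lA lC lB lD.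
(* Beyond their ends the paths are prolonged along the lines AC and BD; the
   prolongations stay out of the disc and do not meet each other. *)
pose F s : R * R := f (clamp s) + (s - clamp s) *: (C - A).
pose G s : R * R := g (clamp s) + (s - clamp s) *: (D - B).
have F1 s : (F s).1 = (f (clamp s)).1 + (s - clamp s) * (C.1 - A.1) by [].
have F2 s : (F s).2 = (f (clamp s)).2 + (s - clamp s) * (C.2 - A.2) by [].
have G1 s : (G s).1 = (g (clamp s)).1 + (s - clamp s) * (D.1 - B.1) by [].
have G2 s : (G s).2 = (g (clamp s)).2 + (s - clamp s) * (D.2 - B.2) by [].
have crossF s : cross D B (F s) =
    cross D B (f (clamp s)) + (s - clamp s) * (cross D B C - cross D B A).
  by rewrite /cross F1 F2; ring.
have crossG s : cross A C (G s) =
    cross A C (g (clamp s)) + (s - clamp s) * (cross A C D - cross A C B).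
  by rewrite /cross G1 G2; ring.
have crossF' s : cross A C (F s) = cross A C (f (clamp s)).
  by rewrite /cross F1 F2; ring.
have crossG' s : cross D B (G s) = cross D B (g (clamp s)).
  by rewrite /cross G1 G2; ring.
have sq1 (x : R) : x ^+ 2 <= 1 -> -1 <= x <= 1.
  by move=> ?; apply/andP; split; nra.
have coord (X : R * R) : unit_disc X -> -1 <= X.1 <= 1 /\ -1 <= X.2 <= 1.
  rewrite /unit_disc /= => X1.
  have h1 := sqr_ge0 (X.1); have h2 := sqr_ge0 (X.2).
  by split; apply: sq1; lra.
(* Differences of coordinates have absolute value at most 2, so [cross] is at most 8 in absolute
   value. *)
have bound (P Q X : R * R) : unit_disc P -> unit_disc Q -> unit_disc X ->
    -9 < cross P Q X < 9.
  move=> /coord[/andP[? ?] /andP[? ?]] /coord[/andP[? ?] /andP[? ?]].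
  move=> /coord[/andP[? ?] /andP[? ?]].
  have small (x y : R) : -2 <= x <= 2 -> -2 <= y <= 2 -> -4 <= x * y <= 4.
    by move=> /andP[? ?] /andP[? ?]; apply/andP; split; nra.
  have /andP[? ?] := small (Q.1 - P.1) (X.2 - P.2) ltac:(lra) ltac:(lra).
  have /andP[? ?] := small (Q.2 - P.2) (X.1 - P.1) ltac:(lra) ltac:(lra).
  by rewrite /cross; lra.
have [dA dC] : unit_disc A /\ unit_disc C.
  by rewrite -f0 -f1; split; apply: df; rewrite ?lexx ?ler01.
have [dB dD] : unit_disc B /\ unit_disc D.
  by rewrite -g0 -g1; split; apply: dg; rewrite ?lexx ?ler01.
pose la := cross D B C - cross D B A; pose mu := cross A C D - cross A C B.
have la0 : 0 < la by rewrite /la; lra.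
have mu0 : 0 < mu by rewrite /mu; lra.
(* A prolongation by [K] moves the coordinate of its path by more than 9, beyond the reach of the
   other path. [S] maps the unit interval onto the interval from [- K] to [K + 1]. *)
pose K := 9 / la + 9 / mu.
have K0 : 0 < K by rewrite addr_gt0 // divr_gt0.
have Kla : 9 < K * la.
  by rewrite /K mulrDl divfK ?gt_eqF // ltrDl mulr_gt0 // divr_gt0.
have Kmu : 9 < K * mu.
  by rewrite /K mulrDl divfK ?gt_eqF // ltrDr mulr_gt0 // divr_gt0.
pose S (x : R) := (2 * K + 1) * x - K.
have S0 : clamp (S 0) = 0 by apply: clamp_neg; rewrite /S; lra.
have S1 : clamp (S 1) = 1 by apply: clamp_big; rewrite /S; lra.
have contS : continuous S.
  by move=> x; apply: cvgB; [apply: cvgM; [exact: cvg_cst|exact: cvg_id]|exact: cvg_cst].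
have cont1 (h : R -> R * R) (v : R * R) : continuous h ->
    continuous (fun s => h (clamp s) + (s - clamp s) *: v).
  move=> ch s; apply: cvgD.
    by apply: (@continuous_comp _ _ _ clamp h); [exact: clamp_continuous|exact: ch].
  apply: cvgZ; last exact: cvg_cst.
  by apply: cvgB; [exact: cvg_id|exact: clamp_continuous].
have cont2 (P Q : R * R) (H : R -> R * R) : continuous H ->
    continuous (fun x => cross P Q (H (S x))).
  move=> cH x.
  have c : {for x, continuous (fun x => H (S x))}.
    by apply: (@continuous_comp _ _ _ S H); [exact: contS|exact: cH].
  have c1 : {for x, continuous (fun x => (H (S x)).1)}.
    exact: (@continuous_comp _ _ _ (fun x => H (S x)) fst _ c cvg_fst).
  have c2 : {for x, continuous (fun x => (H (S x)).2)}.
    exact: (@continuous_comp _ _ _ (fun x => H (S x)) snd _ c cvg_snd).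
  apply: cvgB; (apply: cvgM; first exact: cvg_cst).
    by apply: cvgB c2 _; exact: cvg_cst.
  by apply: cvgB c1 _; exact: cvg_cst.
have cF : continuous F by exact: cont1.
have cG : continuous G by exact: cont1.
have fst_cont (h : R -> R) : continuous h -> continuous (fun x : R * R => h x.1).
  by move=> ch x; apply: (@continuous_comp _ _ _ fst h); [exact: cvg_fst|exact: ch].
have snd_cont (h : R -> R) : continuous h -> continuous (fun x : R * R => h x.2).
  by move=> ch x; apply: (@continuous_comp _ _ _ snd h); [exact: cvg_snd|exact: ch].
have [||||s0 [t0 [_ _ /= e1 e2]]] := @square_zero
    (fun x => cross D B (F (S x.1)) - cross D B (G (S x.2)))
    (fun x => cross A C (G (S x.2)) - cross A C (F (S x.1))).
- move=> x; apply: cvgB.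
    exact: (fst_cont _ (cont2 D B F cF)).
  exact: (snd_cont _ (cont2 D B G cG)).
- move=> x; apply: cvgB.
    exact: (snd_cont _ (cont2 A C G cG)).
  exact: (fst_cont _ (cont2 A C F cF)).
- move=> t t01 /=; rewrite !crossF !crossG' S0 S1 f0 f1 -/la.
  have /andP[b1 b2] := bound D B _ dD dB (dg _ (clamp01 (S t))).
  by rewrite /S; split; nra.
- move=> t t01 /=; rewrite !crossG !crossF' S0 S1 g0 g1 -/mu.
  have /andP[b1 b2] := bound A C _ dA dC (df _ (clamp01 (S t))).
  by rewrite /S; split; nra.
move: e1 e2; move: (S s0) (S t0) => s t /subr0_eq e1 /subr0_eq e2.
have e : F s = G t.
  (* [la] is the determinant of [B - D] and [C - A], so Cramer's rule recovers a point from its two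
     coordinates. *)
  have la' : (F s).1 * la = (G t).1 * la /\ (F s).2 * la = (G t).2 * la.
    split; apply/eqP; rewrite -subr_eq0; apply/eqP.
      transitivity ((cross D B (F s) - cross D B (G t)) * (C.1 - A.1) +
        (cross A C (G t) - cross A C (F s)) * (B.1 - D.1)).
        by rewrite /la /cross; ring.
      by rewrite e1 e2 !subrr !mul0r addr0.
    transitivity ((cross D B (F s) - cross D B (G t)) * (C.2 - A.2) +
      (cross A C (G t) - cross A C (F s)) * (B.2 - D.2)).
      by rewrite /la /cross; ring.
    by rewrite e1 e2 !subrr !mul0r addr0.
  case: la' => /(mulIf (lt0r_neq0 la0)) h1 /(mulIf (lt0r_neq0 la0)) h2.
  by rewrite [F s]surjective_pairing h1 h2 -surjective_pairing.
have line (h : R -> R * R) (P Q : R * R) r : h 0 = P -> h 1 = Q -> ~ (0 <= r <= 1) ->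
    h (clamp r) + (r - clamp r) *: (Q - P) = P + r *: (Q - P).
  move=> h0 h1 /negP; rewrite negb_and -!ltNge => /orP[r0|r1].
    by rewrite clamp_neg ?h0 ?subr0 // ltW.
  by rewrite clamp_big ?h1 ?ltW // scalerBl scale1r opprB addrCA subrKC addrC.
have far (P Q : R * R) r : P.1 ^+ 2 + P.2 ^+ 2 = 1 -> Q.1 ^+ 2 + Q.2 ^+ 2 = 1 ->
    P != Q -> ~ (0 <= r <= 1) -> ~ unit_disc (P + r *: (Q - P)).
  move=> nP nQ PQ r01; rewrite /unit_disc /=.
  have : 0 < (Q.1 - P.1) ^+ 2 + (Q.2 - P.2) ^+ 2.
    rewrite lt_neqAle addr_ge0 ?sqr_ge0 // andbT eq_sym paddr_eq0 ?sqr_ge0 //.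
    rewrite !sqrf_eq0 !subr_eq0; apply: contra PQ => /andP[/eqP q1 /eqP q2].
    by rewrite [P]surjective_pairing [Q]surjective_pairing q1 q2.
  have : 0 < r ^+ 2 - r.
    by move/negP: r01; rewrite negb_and -!ltNge => /orP[r0|r1]; nra.
  move=> /mulr_gt0 /[apply] pos.
  have -> : (P.1 + r *: (Q.1 - P.1)) ^+ 2 + (P.2 + r *: (Q.2 - P.2)) ^+ 2 =
    (P.1 ^+ 2 + P.2 ^+ 2) * (1 - r) + (Q.1 ^+ 2 + Q.2 ^+ 2) * r +
    (r ^+ 2 - r) * ((Q.1 - P.1) ^+ 2 + (Q.2 - P.2) ^+ 2).
    by rewrite /GRing.scale /=; ring.
  by rewrite nP nQ; lra.
have AC : A != C by apply/eqP => h; have := lt_trans lA lC; rewrite h ltxx.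
have BD : B != D by apply/eqP => h; have := lt_trans lB lD; rewrite h ltxx.
have in01 (h : R -> R * R) r v : 0 <= r <= 1 -> h (clamp r) + (r - clamp r) *: v = h r.
  by move=> r01; rewrite clamp_id // subrr scale0r addr0.
have [s01|/negP s01] := boolP (0 <= s <= 1).
  have [t01|/negP t01] := boolP (0 <= t <= 1).
    by exists s, t; split=> //; rewrite -(in01 f s (C - A)) // -(in01 g t (D - B)).
  case: (far B D t nB nD BD t01); rewrite -(line g) // -/(G t) -e /F in01 //.
  exact: df.
have [t01|/negP t01] := boolP (0 <= t <= 1).
  case: (far A C s nA nC AC s01); rewrite -(line f) // -/(F s) e /G in01 //.
  exact: dg.
(* Both points lie on prolongations: the first is on the line AC, while the second is strictly on
   one side of it, beyond B or beyond D. *)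
exfalso; move: e2; rewrite crossF' crossG -/mu.
have -> : cross A C (f (clamp s)) = 0.
  move/negP: s01; rewrite negb_and -!ltNge => /orP[/ltW s0'|/ltW s1'].
    by rewrite clamp_neg // f0 /cross; ring.
  by rewrite clamp_big // f1 /cross; ring.
move/negP: t01; rewrite negb_and -!ltNge => /orP[t0'|t1'].
  by rewrite clamp_neg ?ltW // g0; nra.
by rewrite clamp_big ?ltW // g1; nra.
Qed.

Lemma sub_cos_sin (a b : R) :
  cos (b *+ 2) - cos (a *+ 2) = - (sin (a + b) * sin (b - a)) *+ 2 /\
  sin (b *+ 2) - sin (a *+ 2) = (cos (a + b) * sin (b - a)) *+ 2.
Proof.
rewrite !mulr2n !cosD !sinD !cosN !sinN.
have ha := cos2Dsin2 a; have hb := cos2Dsin2 b.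
split.
  transitivity ((cos b ^+ 2 - sin b ^+ 2) * (cos a ^+ 2 + sin a ^+ 2) -
    (cos a ^+ 2 - sin a ^+ 2) * (cos b ^+ 2 + sin b ^+ 2)).
    by rewrite ha hb; ring.
  by ring.
transitivity (2 * (sin b * cos b) * (cos a ^+ 2 + sin a ^+ 2) -
  2 * (sin a * cos a) * (cos b ^+ 2 + sin b ^+ 2)).
  by rewrite ha hb; ring.
by ring.
Qed.

(** With half angles [x], [y], [z] the area factors as 4 sin(y - x) sin(z - x) sin(z - y), and all
    three differences lie between 0 and [pi]. *)
Lemma cross_circle (a b c : R) : a < b -> b < c -> c < a + 2 * pi ->
  0 < cross (cos a, sin a) (cos b, sin b) (cos c, sin c).
Proof.
move=> ab bc ca; rewrite /cross /=.
have half (x : R) : x = (x / 2) *+ 2 by rewrite mulr2n; lra.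
rewrite [a]half [b]half [c]half.
set x := a / 2; set y := b / 2; set z := c / 2.
have [-> ->] := sub_cos_sin x y; have [-> ->] := sub_cos_sin x z.
have pos (u v : R) : u < v -> v < u + pi -> 0 < sin (v - u).
  by move=> uv vu; apply: sin_gt0_pi; rewrite subr_gt0 uv ltrBlDl.
have sxy : 0 < sin (y - x) by apply: pos; rewrite /x /y; lra.
have syz : 0 < sin (z - y) by apply: pos; rewrite /y /z; lra.
have sxz : 0 < sin (z - x) by apply: pos; rewrite /x /z; lra.
have e : sin (z - y) = sin (x + z) * cos (x + y) - cos (x + z) * sin (x + y).
  by rewrite -sinB; congr sin; ring.
have := mulr_gt0 (mulr_gt0 sxy sxz) syz; rewrite e => pos3.
rewrite [ltRHS](_ : _ = 4 * (sin (y - x) * sin (z - x) *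
  (sin (x + z) * cos (x + y) - cos (x + z) * sin (x + y)))); last by ring.
by rewrite mulr_gt0.
Qed.
End PlanePaths.

(** * Planar drawings have no crossing splits *)

Section PlanarNoncrossing.
Variables (R : realType) (n : nat) (T : ltree n).
Variables (pt : T -> R * R) (arc : T -> T -> R -> R * R).
Hypothesis emb : disc_embedding pt arc.
Implicit Types (u v w x y : T) (S : pred T).

Definition drawn S : set (R * R) := [set z | exists u v (t : R),
  [/\ adj u v, S u, S v, t \in `[0, 1] & z = arc u v t]].

Lemma joined_branch v w x p : adj v w -> branch v w x -> path (off v) x p ->
  p != [::] -> joined (drawn (branch v w)) (pt x) (pt (last x p)).
Proof.
move=> vw; have [_ _ arcs _] := emb.
elim: p x => // y p IH x bx /andP[xy yp] _ /=.
have by_ : branch v w y by apply: connect_trans bx (connect1 xy).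
have a : adj x y by case/and3P: xy.
have [carc _ _ [e0 e1] _] := arcs _ _ a.
have xy' : joined (drawn (branch v w)) (pt x) (pt y).
  rewrite -e0 -e1; apply: joined_arc => // s s01.
  by exists x, y, s.
case: p IH yp => [//|z p] IH yp.
exact: joined_trans xy' (IH _ by_ yp _).
Qed.

Lemma joined_leaves v w (i j : 'I_n) : adj v w -> i != j ->
  branch v w (leaf T i) -> branch v w (leaf T j) ->
  joined (drawn (branch v w)) (pt (leaf T i)) (pt (leaf T j)).
Proof.
move=> vw ij bi bj; have bi' := bi; rewrite /branch off_sym in bi'.
have /connectP[p pp e] := connect_trans bi' bj.
rewrite e; apply: joined_branch => //.
apply: contraNneq ij => p0; rewrite p0 /= in e.
by apply/eqP/esym/(@leaf_inj _ T).
Qed.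

(** Arcs of distinct edges meet only in common vertices, and the two sides of an edge share no
    vertex. *)
Lemma drawn_disjoint v w z : adj v w ->
  drawn (branch v w) z -> drawn (branch w v) z -> False.
Proof.
move=> vw [x [y [s [xy bx by_ s01 ->]]]] [x' [y' [t [xy' bx' by' t01 e]]]].
have [_ _ _ meet] := emb.
have ex u : branch v w u -> branch w v u -> False.
  by move=> b; apply/negP; exact: branch_excl.
have ns : ~ same_edge x y x' y'.
  by case=> -[h1 h2]; [apply: (ex x); rewrite // h1 | apply: (ex x); rewrite // h1].
have [u [h1 h2 _]] := meet _ _ _ _ xy xy' ns _ _ s01 t01 e.
apply: (ex u); first by case: h1 => ->.
by case: h2 => ->.
Qed.

Lemma planar_noncrossing : leaves_in_cyclic_order pt -> noncrossing T.
Proof.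
move=> [theta [ptE mono gap]] v w vw a b c d ab bc cd [ba bc' bb bd].
have ac := ltn_trans ab bc; have bd' := ltn_trans bc cd.
have ad := ltn_trans ab bd'.
have ne (i j : 'I_n) : (i < j)%N -> i != j.
  by move=> ij; apply/eqP => e; rewrite e ltnn in ij.
have wv : adj w v by rewrite adj_sym.
have [f [cf f0 f1 fX]] := joined_leaves vw (ne _ _ ac) ba bc'.
have [g [cg g0 g1 gX]] := joined_leaves wv (ne _ _ bd') bb bd.
have drawn_disc S z : drawn S z -> unit_disc z.
  move=> [x [y [s [xy _ _ s01 ->]]]]; have [_ _ arcs _] := emb.
  by have [_ _ + _ _] := arcs _ _ xy; apply.
rewrite !ptE in f0 f1 g0 g1.
have circle r : (cos r, sin r).1 ^+ 2 + (cos r, sin r).2 ^+ 2 = 1 :> R.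
  by rewrite /= cos2Dsin2.
have t (i j : 'I_n) : (i < j)%N -> theta i < theta j by exact: mono.
(* The four sign conditions are orientations of triples of leaves in cyclic order, up to a
   permutation of the arguments of [cross]. *)
have [||||||||||s [r [s01 r01 e]]] := disc_paths_meet cf cg _ _ f0 f1 g0 g1.
all: try exact: circle.
- by move=> s /fX/drawn_disc.
- by move=> s /gX/drawn_disc.
- have := cross_circle (t _ _ ab) (lt_trans (t _ _ bc) (t _ _ cd)) (gap a d).
  by rewrite /cross /=; lra.
- have := cross_circle (t _ _ bc) (t _ _ cd) (gap b d).
  by rewrite /cross /=; lra.
- have := cross_circle (t _ _ ab) (t _ _ bc) (gap a c).
  by rewrite /cross /=; lra.
- have := cross_circle (t _ _ ac) (t _ _ cd) (gap a d).
  by rewrite /cross /=; lra.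
by apply: (drawn_disjoint vw (fX _ s01)); rewrite e; exact: gX.
Qed.

End PlanarNoncrossing.

(** * Straight-line drawings *)

(* The key Z denotes MathComp's int_scope. *)
Delimit Scope Z_scope with ZZ.

(** Drawings and configurations have coordinates in [Z], where the checks are computed; [ofZ]
    carries the results over to the reals. *)
Definition ofZ (R : pzRingType) (z : Z) : R := (int_of_Z z)%:~R.

Section OfZ.
Variable R : realType.

Lemma ofZD (x y : Z) : ofZ R (x + y)%ZZ = ofZ R x + ofZ R y.
Proof. by rewrite /ofZ rmorphD rmorphD. Qed.

Lemma ofZB (x y : Z) : ofZ R (x - y)%ZZ = ofZ R x - ofZ R y.
Proof. by rewrite /ofZ rmorphB rmorphB. Qed.

Lemma ofZM (x y : Z) : ofZ R (x * y)%ZZ = ofZ R x * ofZ R y.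
Proof. by rewrite /ofZ rmorphM rmorphM. Qed.

Lemma ofZ_le (x y : Z) : (ofZ R x <= ofZ R y) = (x <=? y)%ZZ.
Proof. by rewrite /ofZ ler_int; apply/idP/idP; lia. Qed.

Lemma ofZ_lt (x y : Z) : (ofZ R x < ofZ R y) = (x <? y)%ZZ.
Proof. by rewrite /ofZ ltr_int; apply/idP/idP; lia. Qed.

Lemma ofZ_inj : injective (ofZ R).
Proof. by move=> x y /intr_inj; lia. Qed.

End OfZ.

(* Rational points of the unit circle, scaled by 10. *)
Definition hexagon : seq (Z * Z) :=
  [:: (10, 0); (6, 8); (-6, 8); (-10, 0); (-6, -8); (6, -8)]%ZZ.

(* A node with leaves a, ..., b is drawn at the midpoint of the chord from a to b;
   thus disjoint subtrees are drawn in disjoint convex polygons. *)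
Fixpoint node_points t : seq (Z * Z) :=
  match t with
  | Lf _ => [::]
  | Nd t1 t2 =>
    let p := nth (0, 0)%ZZ hexagon (head 0%N (word t)) in
    let q := nth (0, 0)%ZZ hexagon (last 0%N (word t)) in
    ((p.1 + q.1) / 2, (p.2 + q.2) / 2)%ZZ :: node_points t1 ++ node_points t2
  end.

Definition draw t (k : nat) : Z * Z := nth (0, 0)%ZZ (hexagon ++ node_points t) k.

Definition form_at (l : Z * Z * Z) (p : Z * Z) : Z :=
  (l.1.1 * p.1 + l.1.2 * p.2 + l.2)%ZZ.

(* The triple (a, b, c) is the affine form a x + b y + c. These forms vanish on the
   line pq and on its perpendiculars at p and q. *)
Definition forms (p q : Z * Z) : seq (Z * Z * Z) :=
  let dx := (q.1 - p.1)%ZZ in let dy := (q.2 - p.2)%ZZ in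
  [:: (- dy, dx, dy * p.1 - dx * p.2); (dy, - dx, dx * p.2 - dy * p.1);
      (dx, dy, - (dx * p.1 + dy * p.2)); (- dx, - dy, dx * q.1 + dy * q.2)]%ZZ.

(** A certificate by a separating line: the form is nonpositive on [e] and nonnegative on [e'], not
    identically zero on [e], and an end of [e] on the line must be an end of [e']. *)
Definition separates (P : nat -> Z * Z) (e e' : nat * nat) l : bool :=
  let f k := form_at l (P k) in
  let ok k := (f k <? 0)%ZZ || (f k =? 0)%ZZ && ((k == e'.1) || (k == e'.2)) in
  [&& ok e.1, ok e.2, (f e.1 <? 0)%ZZ || (f e.2 <? 0)%ZZ,
      (0 <=? f e'.1)%ZZ & (0 <=? f e'.2)%ZZ].

Definition separated P (e e' : nat * nat) : bool :=
  has (separates P e e') (forms (P e'.1) (P e'.2)) ||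
  has (separates P e' e) (forms (P e.1) (P e.2)).

Definition drawing_ok t : bool :=
  let E := edges 0 6 t in
  [&& uniq [seq draw t k | k <- iota 0 10],
      all (fun k => (draw t k).1 * (draw t k).1 + (draw t k).2 * (draw t k).2 <=? 100)%ZZ
        (iota 0 10),
      all (fun e => (e.1 < 10) && (e.2 < 10))%N E &
      all (fun e => all (fun e' => (e == e') || separated (draw t) e e') E) E].

Lemma drawing_okT t : word t = iota 1 5 -> drawing_ok t.
Proof.
have ok : all drawing_ok (plane_trees 5 (iota 1 5)) by vm_compute.
by move=> wt; apply: all_plane_trees ok wt _.
Qed.

Section Drawing.
Variables (R : realType) (t : bintree).
Hypothesis ok : drawing_ok t.
Implicit Types (r s : R) (e : nat * nat).

Definition plane_point (k : nat) : R * R :=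
  (ofZ R (draw t k).1 / 10, ofZ R (draw t k).2 / 10).

Definition segment (p q : R * R) s : R * R := p + s *: (q - p).

Lemma segment1 p q s : (segment p q s).1 = (1 - s) * p.1 + s * q.1.
Proof. by rewrite /segment /= /GRing.scale /=; ring. Qed.

Lemma segment2 p q s : (segment p q s).2 = (1 - s) * p.2 + s * q.2.
Proof. by rewrite /segment /= /GRing.scale /=; ring. Qed.

Lemma segment_eq p q s x y : (segment p q s).1 = x -> (segment p q s).2 = y ->
  segment p q s = (x, y).
Proof. by move=> <- <-; exact: surjective_pairing. Qed.

Lemma segment_0 p q : segment p q 0 = p.
Proof. by rewrite /segment scale0r addr0. Qed.

Lemma segment_1 p q : segment p q 1 = q.
Proof. by rewrite /segment scale1r subrKC. Qed.

Lemma segment_rev p q s : segment q p s = segment p q (1 - s).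
Proof.
by rewrite [RHS]surjective_pairing; apply: segment_eq; rewrite ?segment1 ?segment2; ring.
Qed.

Definition form_atR (l : Z * Z * Z) (p : R * R) : R :=
  ofZ R l.1.1 * (p.1 * 10) + ofZ R l.1.2 * (p.2 * 10) + ofZ R l.2.

Lemma form_at_point l k : form_atR l (plane_point k) = ofZ R (form_at l (draw t k)).
Proof.
by rewrite /form_atR /form_at !ofZD !ofZM /plane_point /= !divfK // pnatr_eq0.
Qed.

Lemma form_at_segment l p q s :
  form_atR l (segment p q s) = (1 - s) * form_atR l p + s * form_atR l q.
Proof. by rewrite /form_atR segment1 segment2; ring. Qed.

(** At a common point the form vanishes, so both weighted values at the ends of [e] vanish. One end
    has a negative value, hence [r] is 0 or 1 and the point is the other end. *)
Lemma separates_meet e e' l r s : separates (draw t) e e' l ->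
  0 <= r <= 1 -> 0 <= s <= 1 ->
  segment (plane_point e.1) (plane_point e.2) r =
    segment (plane_point e'.1) (plane_point e'.2) s ->
  exists k, [/\ k = e.1 \/ k = e.2, k = e'.1 \/ k = e'.2 &
    segment (plane_point e.1) (plane_point e.2) r = plane_point k].
Proof.
case/and5P => ok1 ok2 neg p1 p2 /andP[r0 r1] /andP[s0 s1] eqx.
have := congr1 (form_atR l) eqx; rewrite !form_at_segment !form_at_point.
have okR k : (form_at l (draw t k) <? 0)%ZZ ||
    (form_at l (draw t k) =? 0)%ZZ && ((k == e'.1) || (k == e'.2)) ->
    ofZ R (form_at l (draw t k)) <= 0 /\
    (ofZ R (form_at l (draw t k)) = 0 -> k = e'.1 \/ k = e'.2).
  case/orP => [neg'|/andP[/Z.eqb_spec -> c]].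
    have := ofZ_lt R (form_at l (draw t k)) 0; rewrite neg' => h.
    split; first exact: ltW.
    by move=> h0; rewrite h0 ltxx in h.
  by split; rewrite /ofZ ?lexx // => _; case/orP: c => /eqP; [left|right].
have [{ok1} le1 c1] := okR _ ok1; have [{ok2} le2 c2] := okR _ ok2.
have {p1} : 0 <= ofZ R (form_at l (draw t e'.1)) by rewrite (ofZ_le R 0).
have {p2} : 0 <= ofZ R (form_at l (draw t e'.2)) by rewrite (ofZ_le R 0).
have {neg} : ofZ R (form_at l (draw t e.1)) < 0 \/ ofZ R (form_at l (draw t e.2)) < 0.
  by case/orP: neg => h; [left|right]; rewrite (ofZ_lt R _ 0).
move: le1 c1 le2 c2; set a := ofZ R _; set b := ofZ R _; set d := ofZ R _; set c := ofZ R _.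
move=> a0 ca b0 cb neg d0 c0 e1.
have ra : 0 <= (1 - r) * - a by rewrite mulr_ge0 // ?subr_ge0 // oppr_ge0.
have rb : 0 <= r * - b by rewrite mulr_ge0 // oppr_ge0.
have sc : 0 <= (1 - s) * c by rewrite mulr_ge0 // subr_ge0.
have sd : 0 <= s * d by rewrite mulr_ge0.
have /eqP : (1 - r) * a = 0 by lra.
have /eqP : r * b = 0 by lra.
rewrite !mulf_eq0 => /orP rb0 /orP ra0.
case: neg => neg.
  have r_1 : r = 1.
    by case: ra0 => /eqP; [lra|move=> h; rewrite h ltxx in neg].
  exists e.2; rewrite r_1 segment_1; split=> //; first by right.
  by apply: cb; case: rb0 => /eqP // h; rewrite r_1 in h; lra.
have r_0 : r = 0.
  by case: rb0 => /eqP // h; rewrite h ltxx in neg.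
exists e.1; rewrite r_0 segment_0; split=> //; first by left.
by apply: ca; case: ra0 => /eqP // h; rewrite r_0 in h; lra.
Qed.

Lemma separated_meet e e' r s : separated (draw t) e e' ->
  0 <= r <= 1 -> 0 <= s <= 1 ->
  segment (plane_point e.1) (plane_point e.2) r =
    segment (plane_point e'.1) (plane_point e'.2) s ->
  exists k, [/\ k = e.1 \/ k = e.2, k = e'.1 \/ k = e'.2 &
    segment (plane_point e.1) (plane_point e.2) r = plane_point k].
Proof.
move=> /orP[/hasP[l _ h]|/hasP[l _ h]] r01 s01 eqx.
  exact: separates_meet h r01 s01 eqx.
have [k [k1 k2 ek]] := separates_meet h s01 r01 (esym eqx).
by exists k; split=> //; rewrite eqx.
Qed.


Lemma plane_point_inj j k : (j < 10)%N -> (k < 10)%N ->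
  plane_point j = plane_point k -> j = k.
Proof.
move=> j10 k10 [e1 e2]; case/and4P: ok => u _ _ _.
have ten : (10 : R)^-1 \is a GRing.unit by rewrite unitrV unitfE pnatr_eq0.
have {e1} e1 := ofZ_inj (mulIr ten e1); have {e2} e2 := ofZ_inj (mulIr ten e2).
have e : draw t j = draw t k by rewrite [LHS]surjective_pairing e1 e2 -surjective_pairing.
have := nth_uniq (0, 0)%ZZ (s := [seq draw t k | k <- iota 0 10]) (i := j) (j := k).
rewrite size_map size_iota !(nth_map 0%N) ?size_iota // !nth_iota //= !add0n.
by move=> /(_ j10 k10 u); rewrite e eqxx => /esym/eqP.
Qed.

Lemma plane_point_disc k : (k < 10)%N -> unit_disc (plane_point k).
Proof.
move=> k10; case/and4P: ok => _ /allP/(_ k) + _ _.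
rewrite mem_iota => /(_ k10); rewrite -(ofZ_le R) ofZD !ofZM.
have -> : ofZ R 100 = 100 by [].
by rewrite /unit_disc /plane_point /=; lra.
Qed.

Lemma segment_disc p q s : unit_disc p -> unit_disc q -> 0 <= s <= 1 ->
  unit_disc (segment p q s).
Proof.
rewrite /unit_disc /= -![_ *: _]/(_ * _) => hp hq /andP[s0 s1].
have e : (p.1 + s * (q.1 - p.1)) ^+ 2 + (p.2 + s * (q.2 - p.2)) ^+ 2 =
  (1 - s) * (p.1 ^+ 2 + p.2 ^+ 2) + s * (q.1 ^+ 2 + q.2 ^+ 2)
  - s * (1 - s) * ((q.1 - p.1) ^+ 2 + (q.2 - p.2) ^+ 2) by ring.
rewrite e.
have h1 : 0 <= (1 - s) * (1 - (p.1 ^+ 2 + p.2 ^+ 2)) by rewrite mulr_ge0 // subr_ge0.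
have h2 : 0 <= s * (1 - (q.1 ^+ 2 + q.2 ^+ 2)) by rewrite mulr_ge0 // subr_ge0.
have h3 : 0 <= s * (1 - s) * ((q.1 - p.1) ^+ 2 + (q.2 - p.2) ^+ 2).
  by rewrite !mulr_ge0 ?subr_ge0 ?addr_ge0 ?sqr_ge0.
lra.
Qed.

Lemma segment_inj p q : p != q -> injective (segment p q).
Proof.
move=> pq r s e; have := congr1 fst e; have := congr1 snd e.
rewrite !segment1 !segment2 => e2 e1; apply/eqP; rewrite -subr_eq0.
apply: contraT => rs.
have /eqP : (r - s) * (q.1 - p.1) = 0 by lra.
have /eqP : (r - s) * (q.2 - p.2) = 0 by lra.
rewrite !mulf_eq0 (negPf rs) !subr_eq0 /= => /eqP q2 /eqP q1.
by case/eqP: pq; rewrite [LHS]surjective_pairing -q1 -q2 -surjective_pairing.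
Qed.

(** The arguments of the points of [hexagon]: the point (6, 8) / 10 has angle [acos (3 / 5)], and
    the others follow by symmetry. *)
Definition leaf_angles : seq R :=
  let a := acos (3 / 5) in [:: 0; a; pi - a; pi; pi + a; 2 * pi - a].

Lemma acos35 : [/\ 0 < acos (3 / 5 : R) < pi / 2,
  cos (acos (3 / 5 : R)) = 3 / 5 & sin (acos (3 / 5 : R)) = 4 / 5].
Proof.
have b : -1 <= (3 / 5 : R) <= 1 by apply/andP; split; lra.
split; last 2 first.
- by rewrite acosK // in_itv.
- rewrite sin_acos //.
  have -> : 1 - (3 / 5) ^+ 2 = (4 / 5 : R) ^+ 2 by field.
  by rewrite sqrtr_sqr ger0_norm //; lra.
rewrite acos_gt0; last by apply/andP; split; lra.
have p0 : 0 < pi :> R := pi_gt0 R.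
rewrite -ltr_cos ?in_itv /= ?acos_ge0 ?acos_lepi //.
  by rewrite cos_pihalf acosK ?in_itv //; lra.
by apply/andP; split; lra.
Qed.



Lemma leaf_angles_ok :
  [/\ forall i, (i < 6)%N -> plane_point i =
        (cos (nth 0 leaf_angles i), sin (nth 0 leaf_angles i)),
      forall i j, (i < j)%N -> (j < 6)%N -> nth 0 leaf_angles i < nth 0 leaf_angles j &
      forall i j, (i < 6)%N -> (j < 6)%N ->
        nth 0 leaf_angles j < nth 0 leaf_angles i + 2 * pi].
Proof.
have [/andP[a0 a1] ca sa] := acos35; have p0 : 0 < pi :> R := pi_gt0 R.
have pt0 x y x' y' : x = x' * 10 -> y = y' * 10 -> (x / 10, y / 10) = (x', y') :> R * R.
  by move=> -> ->; rewrite !mulfK ?pnatr_eq0.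
have twopi : 2 * pi = pi + pi :> R by rewrite mulr_natl mulr2n.
have c2 : cos (2 * pi) = 1 :> R by rewrite twopi cosD cospi sinpi; lra.
have s2 : sin (2 * pi) = 0 :> R by rewrite twopi sinD cospi sinpi; lra.
have z10 : ofZ R 10 = 10 by []. have z6 : ofZ R 6 = 6 by [].
have z8 : ofZ R 8 = 8 by []. have z0 : ofZ R 0 = 0 by [].
have n10 : ofZ R (-10)%ZZ = - 10 by []. have n6 : ofZ R (-6)%ZZ = - 6 by [].
have n8 : ofZ R (-8)%ZZ = - 8 by [].
split.
- move=> i; rewrite /leaf_angles /plane_point.
  case: i => [|[|[|[|[|[|//]]]]]] _ /=; apply: pt0;
    rewrite ?cos0 ?sin0 ?[cos (pi - _)]cosB ?[sin (pi - _)]sinB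
      ?[cos (2 * pi - _)]cosB ?[sin (2 * pi - _)]sinB ?[cos (pi + _)]cosD
      ?[sin (pi + _)]sinD ?c2 ?s2 ?cospi ?sinpi ?ca ?sa ?z10 ?z6 ?z8 ?z0 ?n10 ?n6 ?n8; lra.
- move=> i j ij j6; have so : sorted <%R leaf_angles.
    by rewrite /= andbT; apply/and5P; split; lra.
  by apply: (sorted_ltn_nth lt_trans 0 so); rewrite ?inE //; exact: ltn_trans j6.
- have bounds i : (i < 6)%N -> 0 <= nth 0 leaf_angles i < 2 * pi.
    by case: i => [|[|[|[|[|[|//]]]]]] _ /=; apply/andP; split; lra.
  by move=> i j /bounds/andP[i0 _] /bounds/andP[_ j2]; lra.
Qed.

End Drawing.

Lemma segment_continuous (R : realType) (p q : R * R) : continuous (segment p q).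
Proof.
move=> s; apply: cvgD; first exact: cvg_cst.
by apply: cvgZ; [exact: cvg_id | exact: cvg_cst].
Qed.

Lemma numbering_planar (R : realType) (T : ltree 6) t x0 vs : word t = iota 1 5 ->
  @numbering T t x0 vs -> planar_in_cyclic_order R T.
Proof.
move=> wt [uvs svs invs lvs adjE].
have ok := drawing_okT wt.
pose pt (v : T) := plane_point R t (index v vs).
have ind10 v : (index v vs < 10)%N by rewrite -svs index_mem.
have nthI v : nth x0 vs (index v vs) = v by rewrite nth_index.
have ptI : injective pt.
  move=> u v /(plane_point_inj ok (ind10 u) (ind10 v)) e.
  by rewrite -(nthI u) e nthI.
have ptD v : unit_disc (pt v) by exact: plane_point_disc ok _ (ind10 v).
have in01 (s : R) : s \in `[0, 1] -> 0 <= s <= 1 by rewrite in_itv.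
exists pt, (fun u v => segment (pt u) (pt v)); split; last first.
  have [l1 l2 l3] := leaf_angles_ok R t.
  exists (fun i => nth 0 (leaf_angles R) i); split.
  - move=> i; rewrite -l1 // /pt -(lvs i) index_uniq // svs.
    by apply: ltn_trans (ltn_ord i) _.
  - by move=> i j ij; apply: l2.
  - by move=> i j; apply: l3.
split=> // [u v uv|u v u' v' uv uv' ns r s /in01 r01 /in01 s01 eqx].
  split.
  - exact/continuous_subspaceT/segment_continuous.
  - move=> r s _ _; apply: segment_inj.
    by apply: contra_neq (adj_neq uv) => /ptI.
  - by move=> s /in01 s01; exact: segment_disc.
  - by rewrite segment_0 segment_1.
  - by move=> s _; exact: segment_rev.
(* [edges] lists each edge in one orientation; for the other one the parameter is reversed. *)
have edge a b (q : R) : adj a b -> 0 <= q <= 1 -> exists e q',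
    [/\ e \in edges 0 6 t, 0 <= q' <= 1,
        segment (pt a) (pt b) q = segment (plane_point R t e.1) (plane_point R t e.2) q' &
        e = (index a vs, index b vs) \/ e = (index b vs, index a vs)].
  move=> + q01; rewrite -{1}(nthI a) -{1}(nthI b) adjE ?ind10 // => /orP[h|h].
    by exists (index a vs, index b vs), q; split=> //; left.
  exists (index b vs, index a vs), (1 - q); split=> //; last by right.
    by move/andP: q01 => [? ?]; apply/andP; split; lra.
  exact: segment_rev.
have [e [r' [eE r01' er he]]] := edge _ _ r uv r01.
have [e' [s' [eE' s01' es he']]] := edge _ _ s uv' s01.
have indI a b : index a vs = index b vs -> a = b.
  by move=> h; rewrite -(nthI a) h nthI.
case/and4P: (ok) => _ _ _ /allP/(_ e eE)/allP/(_ e' eE')/orP[/eqP ee|sep].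
  case: ns; rewrite -ee in he'.
  case: he he' => -> [[]|[]] /indI-> /indI->; by [left|right].
have [k [k1 k2 ek]] : exists k, [/\ k = e.1 \/ k = e.2, k = e'.1 \/ k = e'.2 &
    segment (plane_point R t e.1) (plane_point R t e.2) r' = plane_point R t k].
  by apply: separated_meet sep r01' s01' _; rewrite -er -es.
exists (nth x0 vs k).
have kk a b (f : nat * nat) :
    f = (index a vs, index b vs) \/ f = (index b vs, index a vs) ->
    k = f.1 \/ k = f.2 -> (nth x0 vs k = a \/ nth x0 vs k = b) /\ (k < 10)%N.
  by case=> -> [] -> /=; rewrite nthI; split; rewrite ?ind10 //; [left|right|right|left].
have [h1 k10] := kk _ _ _ he k1; have [h2 _] := kk _ _ _ he' k2.
by split=> //; rewrite er ek /pt index_uniq ?svs.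
Qed.

(** * Tropical lines *)

(** Differences of coordinates determine a point of tropical projective space; the arguments below
    are carried out on them, mostly by linear arithmetic. *)
Lemma tpeqP (R : pzRingType) n (a b : 'rV[R]_n) :
  tpeq a b <-> forall x y, a 0 x - a 0 y = b 0 x - b 0 y.
Proof.
split=> [[c ->] x y|]; first by rewrite !mxE opprD addrACA subrr addr0.
case: n a b => [|n] a b h.
  by exists 0; apply/rowP => -[].
exists (b 0 0 - a 0 0); apply/rowP => x; rewrite !mxE.
by rewrite addrCA (h x 0) subrKC.

Qed.

Definition indicator (R : pzRingType) n (J : pred 'I_n) : 'rV[R]_n :=
  \row_j (J j)%:R.

Definition strip_length_ok (R : realType) (c : option R) (s : R) : bool :=
  if c is Some c' then s <= c' else true.

(* c is the length of the segment; c = None gives a half ray. *)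
Definition strip (R : realType) n (p : 'rV[R]_n) (J : pred 'I_n) (c : option R) :
    set 'rV[R]_n :=
  [set a | exists s, [/\ 0 <= s, strip_length_ok c s & tpeq a (p + s *: indicator R J)]].

(* The least upper bound of a_x - a_y on the strip, None standing for infinity. *)
Definition strip_bound (R : realType) n (p : 'rV[R]_n) (J : pred 'I_n) (c : option R)
    (x y : 'I_n) : option R :=
  if J x && ~~ J y then omap (fun c' => p 0 x - p 0 y + c') c
  else Some (p 0 x - p 0 y).

Definition bounded_by (R : realType) (r : R) (b : option R) : bool :=
  if b is Some b' then r <= b' else true.

Section Strip.
Variables (R : realType) (n : nat).
Implicit Types (a p : 'rV[R]_n) (J D : pred 'I_n) (c : option R).

(** A strip is the solution set of difference constraints. The parameter is read off from one index
    in [J] and one outside, and the constraints then force all other differences. *)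
Lemma stripP p J c a x0 y0 : J x0 -> ~~ J y0 ->
  strip p J c a <-> forall x y, bounded_by (a 0 x - a 0 y) (strip_bound p J c x y).
Proof.
move=> Jx0 Jy0; split.
  case=> s [s0 sc /tpeqP e] x y; rewrite e !mxE /strip_bound.
  case: (J x); case: (J y) => /=; try lra.
  by case: c sc => //= c' sc; lra.
move=> h; exists ((a 0 x0 - a 0 y0) - (p 0 x0 - p 0 y0)).
have := h y0 x0; have := h x0 y0; rewrite /strip_bound Jx0 (negPf Jy0) /= => h1 h2.
split; first by lra.
  by case: c h h1 => //= c' _ h1; lra.
apply/tpeqP => x y; rewrite !mxE.
have := h x0 x; have := h x x0; have := h y0 x; have := h x y0.
have := h x0 y; have := h y x0; have := h y0 y; have := h y y0.
rewrite /strip_bound Jx0 (negPf Jy0) /=.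
by case: (J x); case: (J y) => /=; case: c h h1 => //= *; lra.
Qed.

(** A constraint violated by a positive gap stays violated while [t] is below the gap, as adding [t]
    times an indicator lowers a difference by at most [t]. *)
Lemma strip_closed p J c a D x0 y0 : J x0 -> ~~ J y0 -> ~ strip p J c a ->
  \forall t \near 0^'+, ~ strip p J c (a + t *: indicator R D).
Proof.
move=> Jx0 Jy0 /(stripP _ _ _ Jx0 Jy0)/existsNP[x /existsNP[y]].
case e : (strip_bound p J c x y) => [b|//] /= /negP; rewrite -ltNge => ab.
have gap : 0 < a 0 x - a 0 y - b by rewrite subr_gt0.
near=> t; apply/(stripP _ _ _ Jx0 Jy0) => /(_ x y); rewrite e !mxE /=.
have t0 : 0 < t by near: t; exact: nbhs_right_gt.
have tg : t < a 0 x - a 0 y - b by near: t; exact: nbhs_right_lt.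
by case: (D x); case: (D y) => /=; lra.
Unshelve. all: by end_near. Qed.

End Strip.

Section Cells.
Variables (R : realType) (n : nat) (T : ltree n) (pos : T -> 'rV[R]_n).
Implicit Types (v w : T) (a : 'rV[R]_n) (J : pred 'I_n).

Lemma cell_ray v i J a : J =1 pred1 i ->
  cell pos v (leaf T i) a <-> strip (pos v) J None a.
Proof.
move=> Ji; have eI : indicator R J = delta_mx 0 i.
  by apply/rowP => j; rewrite !mxE Ji.
split=> [[[j [s [/leaf_inj <- s0 e]]]|[]]|[s [s0 _ e]]].
- by exists s; rewrite eI.
- by rewrite inner_leaf.
- by left; exists i, s; rewrite -eI.
Qed.

Lemma cell_segment v w J c a : inner w -> 0 < c ->
  tpeq (pos w) (pos v + c *: indicator R J) ->
  cell pos v w a <-> strip (pos v) J (Some c) a.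
Proof.
move=> iw c0 /tpeqP ec.
split=> [[[j [s [ew _ _]]]|[_ [s [s0 s1 /tpeqP e]]]]|].
- by move: iw; rewrite ew inner_leaf.
- exists (s * c); split; [by rewrite mulr_ge0 // ltW|by rewrite /= ler_piMl // ltW|].
  apply/tpeqP => x y; have := ec x y; have := e x y; rewrite !mxE => h1 h2.
  have h3 := congr1 (fun z => s * z) h2; lra.
- case=> s [s0 /= sc /tpeqP e]; right; split=> //; exists (s / c); split.
  + by rewrite divr_ge0 // ltW.
  + by rewrite ler_pdivrMr // mul1r.
  + apply/tpeqP => x y; rewrite e; have := ec x y; rewrite !mxE => h2.
    have h3 := congr1 (fun z => s / c * z) h2.
    have sc' : s = s / c * c by rewrite divfK // lt0r_neq0.
    rewrite {1 2}sc'; lra.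
Qed.

End Cells.

(** * Edge directions of a tropical line *)

Section LineDirections.
Variables (R : realType) (T : ltree 6) (pos : T -> 'rV[R]_6).
Hypothesis T3 : trivalent T.
Hypothesis line : tropical_line pos.
Implicit Types (u v w : T) (x y : 'I_6).

Definition side v w : pred 'I_6 := fun i => branch v w (leaf T i).

Lemma side_exists v w : adj v w -> exists i, side v w i.
Proof.
move=> vw; have [t [vl r]] := rep_exists T3 vw.
have := word_neq0 t; case e : (word t) => [//|k s] _.
have kt : k \in word t by rewrite e mem_head.
exists (Ordinal (rep_word_lt r kt)).
by rewrite /side -(rep_word _ vw r).
Qed.

Lemma sideC v w i : adj v w -> side w v i = ~~ side v w i.
Proof. exact: branchC. Qed.

Lemma side_leaf v i : adj v (leaf T i) -> side v (leaf T i) =1 pred1 i.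
Proof.
move=> vi j; rewrite /side /=; apply/idP/eqP => [/(branch_leaf vi)/leaf_inj//|->].
exact: branch_refl.
Qed.

(** Induction on the branch: by balancing at [w], the vector from [w] back to [v] is minus the sum
    of those to the children, that is, minus the indicator of the side. The vector from [v] to [w]
    is a positive multiple of the opposite, and primitivity fixes the multiple. *)
Lemma out_direction_side v w t vl d : inner v -> adj v w -> rep v w t vl ->
  out_direction pos v w d -> tpeq d (indicator int (side v w)).
Proof.
have [emb bal] := line.
elim: t v w vl d => [k|t1 IH1 t2 IH2] v w vl d iv vw.
  case=> i [ew _ _]; rewrite ew in vw *.
  case=> _ [[j /leaf_inj <- /tpeqP e]|[]]; last by rewrite inner_leaf.
  by apply/tpeqP => x y; rewrite e !mxE (side_leaf vw x) (side_leaf vw y) /= ?eqxx.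
case=> w1 [w2 [l1 [l2 [iw nb u3 _ [r1 r2]]]]].
have wv : adj w v by rewrite adj_sym.
have a1 := node_adj1 nb; have a2 := node_adj2 nb.
have [n1 n2 n12] := node_neq u3.
have [ds [out]] := bal w iw.
have -> : \sum_(x | adj w x) ds x = ds v + (ds w1 + ds w2).
  rewrite (eq_bigl (mem [:: v; w1; w2])); last by move=> x; rewrite nb.
  by rewrite -big_uniq //= !big_cons big_nil addr0.
move=> /tpeqP sum0 [prim [[i ew _]|[_ [c c0 /tpeqP ec]]]].
  by move: iw; rewrite ew inner_leaf.
have [_ [[i ev _]|[_ [c' c'0 /tpeqP ec']]]] := out v wv.
  by move: iv; rewrite ev inner_leaf.
have /tpeqP e1 := IH1 _ _ _ _ iw a1 r1 (out _ a1).
have /tpeqP e2 := IH2 _ _ _ _ iw a2 r2 (out _ a2).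
have sideU i : (side v w i)%:R = (side w w1 i)%:R + (side w w2 i)%:R :> int.
  rewrite /side (branch_node vw nb u3).
  have -> : (leaf T i == w) = false.
    by apply/eqP => ei; move: iw; rewrite -ei inner_leaf.
  have : branch w w1 (leaf T i) -> branch w w2 (leaf T i) -> False.
    by move=> b1 b2; exact: node_disj b1 b2.
  by case: branch; case: branch => // /(_ isT isT).
have dv x y : ds v 0 x - ds v 0 y = (side v w y)%:R - (side v w x)%:R.
  have := sum0 x y; rewrite !sideU !mxE.
  have := e1 x y; have := e2 x y; rewrite !mxE; lra.
have [x0 Jx0] := side_exists vw; have [y0] := side_exists wv.
rewrite sideC // => Jy0.
have cd x y : c * (d 0 x - d 0 y)%:~R = c' * ((side v w x)%:R - (side v w y)%:R).
  have := ec x y; have := ec' x y; rewrite !mxE.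
  have := congr1 (intr : int -> R) (dv x y); rewrite !rmorphB /= !rmorph_nat.
  move=> h1 h2 h3.
  have h4 : c' * ((ds v 0 x)%:~R - (ds v 0 y)%:~R) =
    c' * ((side v w y)%:R - (side v w x)%:R) by rewrite h1.
  lra.
(* [K] is the integer factor between [d] and the indicator; it is positive because [c] and [c'] are,
   and a unit because [d] is primitive. *)
pose K := d 0 x0 - d 0 y0.
have cK : c * K%:~R = c' by rewrite cd Jx0 (negPf Jy0) /=; lra.
have dK x y : d 0 x - d 0 y = K * ((side v w x)%:R - (side v w y)%:R).
  apply: (@intr_inj R); apply: (mulfI (lt0r_neq0 c0)).
  rewrite cd -cK intrM -mulrA; congr (_ * (_ * _)).
  by rewrite rmorphB /= !rmorph_nat.
have : `|K| = 1.
  apply: (prim K (indicator int (side v w))).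
  by apply/tpeqP => x y; rewrite dK !mxE mulrBr.
have K0 : 0 < K.
  by rewrite -(ltr0z R) -(pmulr_rgt0 _ c0) cK.
rewrite gtr0_norm // => K1.
by apply/tpeqP => x y; rewrite dK K1 !mxE mul1r.
Qed.

Lemma bounded_edge v w : inner v -> inner w -> adj v w ->
  exists2 c : R, 0 < c & tpeq (pos w) (pos v + c *: indicator R (side v w)).
Proof.
move=> iv iw vw; have [emb bal] := line; have [ds [out _]] := bal v iv.
have [t [vl r]] := rep_exists T3 vw.
have /tpeqP e := out_direction_side iv vw r (out w vw).
have [_ [[i ew _]|[_ [c c0 /tpeqP ec]]]] := out w vw.
  by move: iw; rewrite ew inner_leaf.
exists c => //; apply/tpeqP => x y; rewrite ec !mxE.
have := congr1 (intr : int -> R) (e x y).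
rewrite !mxE !rmorphB /= !rmorph_nat => h.
have h' : c * ((ds w 0 x)%:~R - (ds w 0 y)%:~R) =
  c * ((side v w x)%:R - (side v w y)%:R) by rewrite h.
lra.
Qed.

Lemma cell_strip v w : inner v -> adj v w -> exists c, forall a,
  cell pos v w a <-> strip (pos v) (side v w) c a.
Proof.
move=> iv vw; have [iw|/innerP[i ew]] := boolP (inner w); last first.
  by rewrite ew in vw *; exists None => a; apply: cell_ray; exact: side_leaf.
have [c c0 ec] := bounded_edge iv iw vw.
by exists (Some c) => a; exact: cell_segment.
Qed.

End LineDirections.

(* The exponents of the six monomials lie in this order on the boundary of a triangle,
   hence the segments [p, r] and [q, u] meet: two edges of a regular subdivision
   cannot cross. *)
Lemma crossing_chords (R : realType) (a : nat -> R) (P Q : 'rV[R]_3) (p q r u : nat) :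
  let f (P : 'rV[R]_3) i := a i + (monomials P)`_i in
  (p < q)%N -> (q < r)%N -> (r < u)%N -> (u < 6)%N ->
  f P p = f P r -> f P p < f P q -> f P p < f P u ->
  f Q q = f Q u -> f Q q < f Q p -> f Q q < f Q r -> False.
Proof.
move=> f; rewrite {}/f /monomials.
case: u => [|[|[|[|[|[|//]]]]]] // + + + _;
case: r => [|[|[|[|[|//]]]]] // + + _;
case: q => [|[|[|[|//]]]] // + _;
case: p => [|[|[|//]]] // _ /=; lra.
Qed.

(** * Alternating edges of a graph on cyclically ordered vertices *)

Lemma connect_exit (I : finType) (e : rel I) (P : pred I) x y :
  connect e x y -> P x -> ~~ P y ->
  exists x' y', [/\ connect e x x', e x' y', P x' & ~~ P y'].
Proof.
move=> /connectP[p pp ->]; elim: p x pp => [|z p IH] x /=; first by move=> _ ->.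
case/andP=> xz pp Px Pl; have [Pz|Pz] := boolP (P z).
  have [x' [y' [c e' Px' Py']]] := IH z pp Pz Pl.
  by exists x', y'; split=> //; exact: connect_trans (connect1 xz) c.
by exists x, z; split=> //; exact: connect0.
Qed.

Section CrossingPaths.
Variables (n : nat) (e : rel 'I_n) (J : pred 'I_n).
Hypothesis e_sym : symmetric e.
Hypothesis e_J : forall x y, e x y -> J x = J y.
Hypothesis e_connect : forall x y, J x = J y -> connect e x y.

Lemma connect_J x y : connect e x y -> J x = J y.
Proof.
by move=> /connectP[p pp ->]; elim: p x pp => //= z p IH x /andP[/e_J -> /IH].
Qed.

(** A path from [i] to [k] enters the interval between [j] and [l] by an edge [x y], which thus
    separates [j] from [l] on the circle. A path from [j] to [l] must then contain an edge
    alternating with [x y]. *)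
Lemma crossing_paths (i j k l : 'I_n) : (i < j)%N -> (j < k)%N -> (k < l)%N ->
  J i = J k -> J j = J l -> J i != J j ->
  exists p q r u : 'I_n, [/\ (p < q)%N, (q < r)%N & (r < u)%N] /\
    [/\ e p r, e q u & J p != J q].
Proof.
move=> ij jk kl Jik Jjl Jij.
have [||x [y [cx xy xin yin]]] :=
  @connect_exit _ e (fun x => (x < j)%N || (l < x)%N) i k (e_connect Jik).
- by rewrite ij.
- by rewrite negb_or -!leqNgt (ltnW jk) (ltnW kl).
have Jx : J x = J i by rewrite (connect_J cx).
have Jy : J y = J i by rewrite -Jx (e_J xy).
have ne z z' : J z != J z' -> (z : nat) <> z'.
  by move=> + h; rewrite (val_inj h) eqxx.
have yj : (y : nat) <> j by apply: ne; rewrite Jy.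
have yl : (y : nat) <> l by apply: ne; rewrite Jy -Jjl.
rewrite negb_or -!leqNgt in yin; case/andP: yin => yin1 yin2.
have jl : (j < l)%N by exact: ltn_trans jk kl.
have fin (z z' : 'I_n) : connect e j z -> e z z' ->
    [/\ J z = J j, J z' = J j, (z : nat) <> x, (z' : nat) <> x &
      (z : nat) <> y /\ (z' : nat) <> y].
  move=> cz zz'; have Jz : J z = J j by rewrite (connect_J cz).
  have Jz' : J z' = J j by rewrite -Jz (e_J zz').
  by split=> //; [| |split]; apply: ne; rewrite ?Jz ?Jz' ?Jx ?Jy eq_sym.
have ltne (b b' : nat) : (b <= b')%N -> b <> b' -> (b < b')%N.
  by rewrite ltn_neqAle => -> /eqP ->.
case/orP: xin => xin.
  have [||z [z' [cz zz' zin zin']]] :=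
    @connect_exit _ e (fun z => (x < z)%N && (z < y)%N) j l (e_connect Jjl).
  - by rewrite xin (ltne _ _ yin1 (nesym yj)).
  - by rewrite negb_and -!leqNgt yin2 orbT.
  have [Jz Jz' zx zx' [zy zy']] := fin _ _ cz zz'.
  case/andP: zin => zin1 zin2; rewrite negb_and -!leqNgt in zin'.
  case/orP: zin' => zin'.
    exists z', x, z, y; split; first by split=> //; exact: ltne.
    by rewrite e_sym zz' xy Jz' Jx eq_sym; split.
  exists x, z, y, z'; split; first by split=> //; exact: ltne (nesym zy').
  by rewrite xy zz' Jz Jx; split.
(* Now [x] is beyond [l], so the arc between [x] and [y] that contains [j] is the complement of an
   interval. *)
have [||z [z' [cz zz' zin zin']]] :=
    @connect_exit _ e (fun z => ~~ ((y < z)%N && (z < x)%N)) j l (e_connect Jjl).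
- by rewrite negb_and -!leqNgt yin1.
- by rewrite negbK xin (ltne _ _ yin2 yl).
have [Jz Jz' zx zx' [zy zy']] := fin _ _ cz zz'.
rewrite negbK in zin'; case/andP: zin' => zin1 zin2; rewrite negb_and -!leqNgt in zin.
case/orP: zin => zin.
  exists z, y, z', x; split; first by split=> //; exact: ltne.
  by rewrite zz' e_sym xy Jz Jy eq_sym; split.
exists y, z', x, z; split; first by split=> //; exact: ltne (nesym zx).
by rewrite e_sym xy e_sym zz' Jz' Jy; split.
Qed.

End CrossingPaths.

(** Provides a parameter below every positive entry of a finite list of gaps. *)
Lemma avoid_seq (R : realType) (c : R) (l : seq R) : 0 < c ->
  exists s, [/\ 0 < s, s < c & forall b, b \in l -> b <= 0 \/ s < b].
Proof.
move=> c0; elim: l => [|b l [s [s0 sc IH]]].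
  by exists (c / 2); split=> //; [rewrite divr_gt0|lra].
have [b0|b0] := leP b 0.
  by exists s; split=> // b'; rewrite in_cons => /predU1P[->|/IH]; [left|].
exists (Num.min s b / 2).
have m0 : 0 < Num.min s b by rewrite lt_min s0.
have ms : Num.min s b <= s by rewrite ge_min lexx.
have mb : Num.min s b <= b by rewrite ge_min lexx orbT.
split; [lra|lra|] => b'; rewrite in_cons => /predU1P[->|/IH[]]; [right;lra|by left|right;lra].
Qed.

(** * Pencils that are tropical lines have no crossing splits *)

Section TropicalNoncrossing.
Variables (R : realType) (T : ltree 6) (pos : T -> 'rV[R]_6).
Variable P : 'I_4 -> 'rV[R]_3.
Hypothesis T3 : trivalent T.
Hypothesis line : tropical_line pos.
Hypothesis supp : line_support pos = pencil P.
Implicit Types (u v w : T) (x y z : 'I_6) (m : 'I_4) (a : 'rV[R]_6).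

Definition value a m x : R := a 0 x + (monomials (P m))`_x.

Definition minimizer a m x : bool := [forall y, value a m x <= value a m y].

Definition linked a x y : bool := [exists m, minimizer a m x && minimizer a m y].

Lemma linked_sym a : symmetric (linked a).
Proof. by move=> x y; apply: eq_existsb => m; rewrite andbC. Qed.

Lemma pencilP a : pencil P a <->
  forall m, exists x y, [/\ x != y, minimizer a m x & minimizer a m y].
Proof.
split=> h m.
  have [x [y [xy e le]]] := h m; exists x, y; split=> //; apply/forallP => z.
    exact: le.
  by rewrite /value -e; exact: le.
have [x [y [xy /forallP mx /forallP my]]] := h m; exists x, y; split=> //.
by apply/eqP; rewrite eq_le mx my.
Qed.

(** The minimal monomials of one point are linked to each other, so they are all raised or all kept.
    The other monomials are larger by a gap, which small [t] does not close. *)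
Lemma shift_pencil a (C : pred 'I_6) : pencil P a ->
  (forall x y, linked a x y -> C x = C y) ->
  \forall t \near 0^'+, pencil P (a + t *: indicator R C).
Proof.
move=> /pencilP pa closed.
have [e [e0 _ gap]] := avoid_seq
  [seq value a h.1 h.2.2 - value a h.1 h.2.1 | h <- enum {: 'I_4 * ('I_6 * 'I_6)}]
  (@ltr01 R).
near=> t.
have t0 : 0 < t by near: t; exact: nbhs_right_gt.
have te : t < e by near: t; exact: nbhs_right_lt.
have vE m x : value (a + t *: indicator R C) m x = value a m x + t * (C x)%:R.
  by rewrite /value !mxE; ring.
apply/pencilP => m; have [x [y [xy mx my]]] := pa m; exists x, y.
have Cxy : C x = C y by apply: closed; apply/existsP; exists m; rewrite mx my.
have min z : minimizer a m z -> C z = C x -> minimizer (a + t *: indicator R C) m z.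
  move=> mz Cz; apply/forallP => z'; rewrite !vE.
  have [mz'|/forallP nz'] := boolP (minimizer a m z').
    have -> : C z' = C z by apply: closed; apply/existsP; exists m; rewrite mz mz'.
    by rewrite lerD2r; exact: (forallP mz z').
  have lt : value a m z < value a m z'.
    rewrite ltNge; apply/negP => le; apply: nz' => z''; apply: le_trans le _.
    exact: (forallP mz z'').
  have : value a m z' - value a m z <= 0 \/ e < value a m z' - value a m z.
    apply: gap; apply/mapP; exists (m, (z, z')) => //; exact: mem_enum.
  by case: (C z); case: (C z') => /=; case; lra.
by split=> //; apply: min.
Unshelve. all: by end_near. Qed.

Lemma tropical_noncrossing : noncrossing T.
Proof.
move=> v w vw i j k l ij jk kl [si sk sj sl].
have [emb bal] := line; case: (emb) => inj meet.
have wv : adj w v by rewrite adj_sym.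
(* A crossing split has two leaves on each side, so its edge is a bounded segment. *)
have iw : inner w.
  have [//|/innerP[i' ew]] := boolP (inner w); rewrite ew in vw si sk.
  have e : leaf T i = leaf T k.
    by rewrite (branch_leaf vw si) (branch_leaf vw sk).
  by move: (ltn_trans ij jk); rewrite (leaf_inj e) ltnn.
have iv : inner v.
  have [//|/innerP[i' ew]] := boolP (inner v); rewrite ew in wv sj sl.
  have e : leaf T j = leaf T l.
    by rewrite (branch_leaf wv sj) (branch_leaf wv sl).
  by move: (ltn_trans jk kl); rewrite (leaf_inj e) ltnn.
have [c c0 /tpeqP ec] := bounded_edge T3 line iv iw vw.
pose J := side v w; rewrite -/J in ec.
have nJ x : side w v x = ~~ J x by exact: branchC.
(* Minimal monomials on both sides would make a difference of values at [pos v] equal to [s]; but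
   each such difference is nonpositive or greater than [s]. *)
have [s [s0 sc sgap]] := avoid_seq
  [seq value (pos v) h.1 h.2.2 - value (pos v) h.1 h.2.1
     | h <- enum {: 'I_4 * ('I_6 * 'I_6)}] c0.
pose a := pos v + s *: indicator R J.
have acell : cell pos v w a.
  apply/(cell_segment (J := J) _ iw c0); first by apply/tpeqP.
  by exists s; split; [exact: ltW|exact: ltW|apply/tpeqP].
have apencil : pencil P a by rewrite -supp; exists v, w.
have vE m x : value a m x = value (pos v) m x + s * (J x)%:R.
  by rewrite /value !mxE; ring.
have linkedJ x y : linked a x y -> J x = J y.
  suff half x' y' : linked a x' y' -> J x' -> J y'.
    move=> h; apply/idP/idP; first exact: half.
    by apply: half; rewrite linked_sym.
  move=> /existsP[m /andP[/forallP/(_ y') + /forallP/(_ x')]].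
  rewrite !vE => h1 h2 Jx'; apply/negPn/negP => Jy'.
  have : value (pos v) m y' - value (pos v) m x' <= 0 \/
         s < value (pos v) m y' - value (pos v) m x'.
    apply: sgap; apply/mapP; exists (m, (x', y')) => //; exact: mem_enum.
  by move: h1 h2; rewrite Jx' (negPf Jy') /=; lra.
have Ji : J i by []. have Jk : J k by [].
have Jj : J j = false by apply/negP => h; have := nJ j; rewrite h /side sj.
have Jl : J l = false by apply/negP => h; have := nJ l; rewrite h /side sl.
have connectJ x0 x : J x0 = J x -> connect (linked a) x0 x.
  move=> Jx0; pose C := connect (linked a) x0.
  have CJ y : C y -> J y = J x0.
    by move=> h; rewrite (connect_J linkedJ h).
  have closed y z : linked a y z -> C y = C z.
    move=> yz; apply/idP/idP => h; first exact: connect_trans h (connect1 yz).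
    by apply: connect_trans h (connect1 _); rewrite linked_sym.
  have near_pencil := shift_pencil apencil closed.
  (* Cells are closed and finite in number: for small [t] the moved point enters no cell that does
     not contain [a]. *)
  have near_cells : \forall t \near 0^'+, forall vw' : T * T,
      inner vw'.1 -> adj vw'.1 vw'.2 -> ~ cell pos vw'.1 vw'.2 a ->
      ~ cell pos vw'.1 vw'.2 (a + t *: indicator R C).
    apply: filter_forall => -[v' w'] /=.
    have [iv'|] := boolP (inner v'); last by move=> _; apply: nearW.
    have [vw'|] := boolP (adj v' w'); last by move=> _; apply: nearW.
    have [c' c'P] := cell_strip T3 line iv' vw'.
    have [x1 J1] := side_exists T3 vw'.
    have [y1] : exists y1, side w' v' y1.
      by apply: side_exists T3 _ _ _; rewrite adj_sym.
    rewrite sideC // => J2.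
    have [/c'P ina|nina] := pselect (strip (pos v') (side v' w') c' a).
      by apply: nearW => t _ _ /(_ ina).
    apply: filterS (strip_closed C J1 J2 nina) => t nt _ _ _ /c'P.
    exact: nt.
  have [t [[tp tc] t0]] := filter_ex
    (filterI (filterI near_pencil near_cells) (nbhs_right_gt 0)).
  have [v' [w' [iv' vw' cell']]] : line_support pos (a + t *: indicator R C).
    by rewrite supp.
  have [acell'|nacell] := pselect (cell pos v' w' a); last first.
    by case: (tc (v', w') iv' vw' nacell).
  (* As [0 < s < c], the point [a] is not an end of its edge, so by [embedded] it lies in no other
     edge. *)
  have same : same_edge v w v' w'.
    apply: contrapT => ns.
    have [u [iu + _ /tpeqP ea]] := meet _ _ _ _ iv iv' vw vw' ns a acell acell'.
    have := ea i j; rewrite /a !mxE Ji Jj /=.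
    by move=> + [eu|eu]; rewrite eu; have := ec i j; rewrite !mxE Ji Jj /=; lra.
  have [r /tpeqP er] : exists r, tpeq (a + t *: indicator R C)
      (pos v + r *: indicator R J).
    case: same cell' => -[<- <-] [[i' [? [e' _ _]]]|[_ [r [_ _ /tpeqP er]]]].
    - by move: iw; rewrite e' inner_leaf.
    - exists (r * c); apply/tpeqP => y z; have := er y z; have := ec y z.
      rewrite !mxE => h1 h2; have h3 := congr1 (fun q : R => r * q) h1; lra.
    - by move: iv; rewrite e' inner_leaf.
    - exists (c - r * c); apply/tpeqP => y z; have := er y z; have := ec y z.
      rewrite !mxE => h1 h2; have h3 := congr1 (fun q : R => r * q) h1; lra.
  (* The move is parallel to the edge. An [x] of the class of [x0] outside [C], compared with some
     [z] of the other class, would give [r = s] and then [t = 0]. *)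
  have key y z : t * ((C y)%:R - (C z)%:R) = (r - s) * ((J y)%:R - (J z)%:R).
    by have := er y z; rewrite /a !mxE; lra.
  have Cx0 : C x0 by exact: connect0.
  apply/negPn/negP => nC.
  have [z Jz] : exists z, J z = ~~ J x0.
    by case: (J x0); [exists j|exists i].
  have nCz : C z = false.
    by apply/negP => /CJ; rewrite Jz; case: (J x0).
  have := key x0 z; have := key x z.
  rewrite (negPf nC : C x = false) nCz Cx0 -Jx0 Jz.
  by case: (J x0) => /=; lra.
have [|||p [q [r [u [[pq qr ru] [pr qu Jpq]]]]]] :=
  crossing_paths (linked_sym a) linkedJ connectJ ij jk kl.
- by rewrite Ji Jk.
- by rewrite Jj Jl.
- by rewrite Ji Jj.
(* Equality would make [y] minimal too, hence linked to [x] and on the same side. *)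
have strict m x y : minimizer a m x -> J x != J y -> value a m x < value a m y.
  move=> mx Jxy; rewrite lt_neqAle (forallP mx y) andbT.
  apply: contra Jxy => /eqP exy; apply/eqP/linkedJ/existsP; exists m.
  by rewrite mx; apply/forallP => z; rewrite -exy; exact: (forallP mx z).
have eqmin m x y : minimizer a m x -> minimizer a m y -> value a m x = value a m y.
  by move=> /forallP mx /forallP my; apply/eqP; rewrite eq_le mx my.
have Jpr := linkedJ _ _ pr; have Jqu := linkedJ _ _ qu.
case/existsP: pr => m /andP[mp mr]; case/existsP: qu => m' /andP[mq mu].
pose f (x : nat) : R := a 0 (inord x).
have fE (m0 : 'I_4) x : value a m0 x = f x + (monomials (P m0))`_x.
  by rewrite /value /f inord_val.
have := @crossing_chords R f (P m) (P m') p q r u pq qr ru (ltn_ord u).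
rewrite -!fE; apply.
- exact: eqmin.
- exact: strict.
- by apply: strict => //; rewrite -Jqu.
- exact: eqmin.
- by apply: strict => //; rewrite eq_sym.
- by apply: strict => //; rewrite eq_sym -Jpr.
Qed.

End TropicalNoncrossing.

(** * Configurations of four points *)

(* Difference bound matrices: the entry d at (x, y) stands for the constraint
   a_x - a_y <= d, None for no constraint. *)
Definition dbm := seq (seq (option Z)).

Definition dget (D : dbm) (x y : nat) : option Z := nth None (nth [::] D x) y.

Definition dmk (f : nat -> nat -> option Z) : dbm :=
  [seq [seq f x y | y <- iota 0 6] | x <- iota 0 6].

Definition omin (b b' : option Z) : option Z :=
  match b, b' with
  | Some d, Some d' => Some (Z.min d d')
  | None, _ => b'
  | _, None => b
  end.

Definition oadd (b b' : option Z) : option Z :=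
  if b is Some d then omap (Z.add d) b' else None.

Definition ole (b b' : option Z) : bool :=
  match b, b' with
  | _, None => true
  | None, _ => false
  | Some d, Some d' => (d <=? d')%ZZ
  end.

Definition dmeet (D D' : dbm) : dbm := dmk (fun x y => omin (dget D x y) (dget D' x y)).

(** The Floyd-Warshall closure: each pass admits [k] as an intermediate index, and a contradictory
    cycle turns up as a negative diagonal entry, which [dempty] detects. *)
Definition dclose (D : dbm) : dbm :=
  foldl (fun D k => dmk (fun x y => omin (dget D x y) (oadd (dget D x k) (dget D k y))))
    D (iota 0 6).

Definition dempty (D : dbm) : bool :=
  has (fun x => if dget D x x is Some d then (d <? 0)%ZZ else false) (iota 0 6).

Definition dimplies (D D' : dbm) : bool :=
  all (fun x => all (fun y => ole (dget D x y) (dget D' x y)) (iota 0 6)) (iota 0 6).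

Definition zcoord (p : seq Z) (x : nat) : Z := nth 0%ZZ p x.

Definition dpoint (p : seq Z) : dbm :=
  dmk (fun x y => Some (zcoord p x - zcoord p y)%ZZ).

Definition dstrip (p : seq Z) (J : nat -> bool) (c : option Z) : dbm :=
  dmk (fun x y => if J x && ~~ J y then omap (Z.add (zcoord p x - zcoord p y)) c
                  else Some (zcoord p x - zcoord p y)%ZZ).

(* The monomials x and y are minimal at a point whose monomials are in r. *)
Definition dminimal (r : seq Z) (x y : nat) : dbm :=
  dmk (fun u z => if (u == x) || (u == y) then Some (zcoord r z - zcoord r u)%ZZ
                  else None).

Definition dfree : dbm := dmk (fun x y => if x == y then Some 0%ZZ else None).

Definition pairs : seq (nat * nat) :=
  [seq e <- [seq (x, y) | x <- iota 0 6, y <- iota 0 6] | (e.1 < e.2)%N].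

(* Every a satisfying D for which each row attains its minimum twice satisfies one
   of the matrices in goals. *)
Fixpoint pencil_covered (goals : seq dbm) (rows : seq (seq Z)) (D : dbm) : bool :=
  if dempty D then true else
  match rows with
  | [::] => has (dimplies D) goals
  | r :: rows' =>
    all (fun e => pencil_covered goals rows' (dclose (dmeet D (dminimal r e.1 e.2)))) pairs
  end.

(* For each tree: the leaf intervals of the non-root nodes in preorder, four points
   (x, y, 0), and the positions of the nodes in preorder. Found by a random search. *)
Definition configurations : seq (seq (nat * nat) * (seq (Z * Z) * seq (seq Z))) :=
  [::
  ([:: (2, 5); (3, 5); (4, 5)]%N,
   ([:: (0, 0); (2, 0); (3, 2); (4, 4)]%ZZ,
    [:: [:: 0; 0; 1; 1; 4; 0]%ZZ;
        [:: 0; 0; 2; 2; 5; 1]%ZZ;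
        [:: 0; 0; 2; 3; 6; 2]%ZZ;
        [:: 0; 0; 2; 3; 7; 3]%ZZ]));
  ([:: (2, 5); (3, 5); (3, 4)]%N,
   ([:: (0, 1); (2, 2); (3, 5); (5, 4)]%ZZ,
    [:: [:: 2; 1; 0; 2; 6; 3]%ZZ;
        [:: 1; 0; 0; 2; 6; 3]%ZZ;
        [:: 1; 0; 0; 3; 7; 4]%ZZ;
        [:: 1; 0; 0; 4; 8; 4]%ZZ]));
  ([:: (2, 5); (2, 3); (4, 5)]%N,
   ([:: (0, 0); (2, 1); (3, 0); (3, 3)]%ZZ,
    [:: [:: 0; 0; 1; 1; 3; 0]%ZZ;
        [:: 0; 0; 2; 2; 4; 1]%ZZ;
        [:: 0; 0; 3; 3; 4; 1]%ZZ;
        [:: 0; 0; 2; 2; 5; 2]%ZZ]));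
  ([:: (2, 5); (2, 4); (3, 4)]%N,
   ([:: (0, 2); (1, 4); (3, 0); (4, 2)]%ZZ,
    [:: [:: 2; 0; 1; 1; 3; 2]%ZZ;
        [:: 2; 0; 2; 2; 4; 3]%ZZ;
        [:: 2; 0; 3; 3; 5; 3]%ZZ;
        [:: 2; 0; 3; 4; 6; 3]%ZZ]));
  ([:: (2, 5); (2, 4); (2, 3)]%N,
   ([:: (0, 2); (2, 3); (4, 2); (4, 4)]%ZZ,
    [:: [:: 3; 1; 0; 2; 6; 3]%ZZ;
        [:: 2; 0; 0; 2; 6; 3]%ZZ;
        [:: 2; 0; 1; 3; 7; 3]%ZZ;
        [:: 2; 0; 2; 4; 7; 3]%ZZ]));
  ([:: (1, 2); (3, 5); (4, 5)]%N,
   ([:: (0, 3); (1, 0); (3, 5); (5, 3)]%ZZ,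
    [:: [:: 3; 0; 1; 3; 6; 3]%ZZ;
        [:: 1; 0; 1; 1; 4; 1]%ZZ;
        [:: 3; 0; 1; 4; 7; 4]%ZZ;
        [:: 3; 0; 1; 4; 8; 5]%ZZ]));
  ([:: (1, 2); (3, 5); (3, 4)]%N,
   ([:: (0, 0); (0, 2); (2, 3); (4, 4)]%ZZ,
    [:: [:: 2; 0; 0; 1; 5; 2]%ZZ;
        [:: 1; 0; 0; 0; 4; 1]%ZZ;
        [:: 2; 0; 0; 2; 6; 3]%ZZ;
        [:: 2; 0; 0; 3; 7; 3]%ZZ]));
  ([:: (1, 3); (2, 3); (4, 5)]%N,
   ([:: (1, 2); (3, 1); (4, 0); (4, 4)]%ZZ,
    [:: [:: 1; 0; 3; 3; 6; 2]%ZZ;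
        [:: 0; 0; 3; 3; 5; 1]%ZZ;
        [:: 0; 0; 4; 4; 5; 1]%ZZ;
        [:: 1; 0; 3; 3; 7; 3]%ZZ]));
  ([:: (1, 3); (1, 2); (4, 5)]%N,
   ([:: (0, 3); (2, 0); (2, 4); (4, 1)]%ZZ,
    [:: [:: 3; 0; 2; 3; 5; 3]%ZZ;
        [:: 2; 0; 2; 3; 4; 2]%ZZ;
        [:: 1; 0; 2; 2; 3; 1]%ZZ;
        [:: 3; 0; 2; 3; 6; 4]%ZZ]));
  ([:: (1, 4); (2, 4); (3, 4)]%N,
   ([:: (0, 3); (1, 2); (2, 1); (4, 3)]%ZZ,
    [:: [:: 3; 0; 0; 1; 4; 3]%ZZ;
        [:: 2; 0; 0; 1; 4; 2]%ZZ;
        [:: 2; 0; 1; 2; 5; 2]%ZZ;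
        [:: 2; 0; 1; 3; 6; 2]%ZZ]));
  ([:: (1, 4); (2, 4); (2, 3)]%N,
   ([:: (0, 3); (1, 2); (3, 1); (3, 3)]%ZZ,
    [:: [:: 3; 0; 0; 1; 4; 3]%ZZ;
        [:: 2; 0; 0; 1; 4; 2]%ZZ;
        [:: 2; 0; 1; 2; 5; 2]%ZZ;
        [:: 2; 0; 2; 3; 5; 2]%ZZ]));
  ([:: (1, 4); (1, 2); (3, 4)]%N,
   ([:: (0, 0); (0, 3); (1, 2); (3, 3)]%ZZ,
    [:: [:: 3; 0; 0; 1; 4; 3]%ZZ;
        [:: 2; 0; 0; 1; 4; 2]%ZZ;
        [:: 1; 0; 0; 0; 3; 1]%ZZ;
        [:: 2; 0; 0; 2; 5; 2]%ZZ]));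
  ([:: (1, 4); (1, 3); (2, 3)]%N,
   ([:: (0, 3); (2, 1); (3, 0); (3, 3)]%ZZ,
    [:: [:: 3; 0; 2; 2; 5; 3]%ZZ;
        [:: 2; 0; 2; 2; 5; 2]%ZZ;
        [:: 1; 0; 2; 2; 4; 1]%ZZ;
        [:: 1; 0; 3; 3; 4; 1]%ZZ]));
  ([:: (1, 4); (1, 3); (1, 2)]%N,
   ([:: (0, 4); (2, 0); (2, 3); (4, 1)]%ZZ,
    [:: [:: 4; 0; 2; 3; 5; 4]%ZZ;
        [:: 3; 0; 2; 3; 5; 3]%ZZ;
        [:: 2; 0; 2; 3; 4; 2]%ZZ;
        [:: 1; 0; 2; 2; 3; 1]%ZZ]))
  ].

Fixpoint spans t : seq (nat * nat) :=
  match t with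
  | Lf _ => [::]
  | Nd t1 t2 => (head 0%N (word t), last 0%N (word t)) :: spans t1 ++ spans t2
  end.

(** The root has the span (1, 5) in every tree considered, so the table is keyed by the remaining
    spans. *)
Definition configuration t : seq (Z * Z) * seq (seq Z) :=
  nth ([::], [::]) [seq c.2 | c <- configurations]
    (find (fun c => c.1 == behead (spans t)) configurations).

Definition points t : seq (Z * Z) := (configuration t).1.
(** The inner vertices have the numbers 6 to 9, hence the shift. *)
Definition position t (j : nat) : seq Z := nth [::] (configuration t).2 (j - 6)%N.

Definition zmonomials (p : Z * Z) : seq Z :=
  [:: 2 * p.1; p.1 + p.2; 2 * p.2; p.2 + 0; 2 * 0; p.1 + 0]%ZZ%ZZ.

Definition rows t : seq (seq Z) := [seq zmonomials p | p <- points t].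

Definition zdiff (p q : seq Z) (x : nat) : Z := (zcoord q x - zcoord p x)%ZZ.

Definition zdiff_min (p q : seq Z) : Z :=
  foldl Z.min (zdiff p q 0) [seq zdiff p q x | x <- iota 0 6].

Definition zdiff_max (p q : seq Z) : Z :=
  foldl Z.max (zdiff p q 0) [seq zdiff p q x | x <- iota 0 6].

(** Along a bounded edge the displacement takes only two values, as [edge_ok] checks; modulo (1,
    ..., 1) it is a multiple of the indicator of the indices with the larger value. *)
Definition out_set t (j k : nat) (x : nat) : bool :=
  if (k < 6)%N then x == k
  else (zdiff_min (position t j) (position t k) <? zdiff (position t j) (position t k) x)%ZZ.

Definition edge_length t (j k : nat) : Z :=
  (zdiff_max (position t j) (position t k) - zdiff_min (position t j) (position t k))%ZZ.

Definition edge_dbm t (e : nat * nat) : dbm :=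
  dstrip (position t e.1) (out_set t e.1 e.2)
    (if (e.2 < 6)%N then None else Some (edge_length t e.1 e.2)).

Definition out_edges t : seq (nat * nat) :=
  [seq e <- [seq (j, k) | j <- iota 6 4, k <- iota 0 10] | tree_edge t e.1 e.2].

Definition edge_ok t (e : nat * nat) : bool :=
  let J := out_set t e.1 e.2 in
  [&& has J (iota 0 6), has (predC J) (iota 0 6) &
    (e.2 < 6)%N ||
    (0 <? edge_length t e.1 e.2)%ZZ &&
    all (fun x => zdiff (position t e.1) (position t e.2) x ==
      if J x then zdiff_max (position t e.1) (position t e.2)
      else zdiff_min (position t e.1) (position t e.2)) (iota 0 6)].

(** The out-sets at a vertex partition the six indices, so their indicators add up to (1, ..., 1),
    which is zero in the quotient. *)
Definition balanced_ok t : bool :=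
  all (fun j => all (fun x =>
    count (fun k => tree_edge t j k && out_set t j k x) (iota 0 10) == 1%N) (iota 0 6))
  (iota 6 4).

(** [D] describes the intersection of two cells: it has to be empty or contained in the position of
    a common inner vertex. The pair [(e'.2, e'.1)] is the segment [e'] seen from its other end. *)
Definition meet_at t (e e' : nat * nat) (D : dbm) : bool :=
  if (e == e') || (e == (e'.2, e'.1)) then true else
  let D := dclose D in
  if dempty D then true else
  has (fun u => if ((u == e.1) || (u == e.2)) && ((u == e'.1) || (u == e'.2))
                then dimplies D (dpoint (position t u)) else false) (iota 6 4).

Definition meet_ok t : bool :=
  let E := [seq (e, edge_dbm t e) | e <- out_edges t] in
  all (fun x => all (fun x' => meet_at t x.1 x'.1 (dmeet x.2 x'.2)) E) E.

Definition positions_ok t : bool :=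
  all (fun j => all (fun k => (j == k) ||
    has (fun x => zdiff (position t j) (position t k) x !=
      zdiff (position t j) (position t k) 0) (iota 0 6)) (iota 6 4)) (iota 6 4).

Definition edges_in_pencil t : bool :=
  all (fun e => let D := edge_dbm t e in
    all (fun r => has (fun xy => dimplies D (dminimal r xy.1 xy.2)) pairs) (rows t))
  (out_edges t).

Definition perm_value (M : seq (seq Z)) (l p : seq nat) : Z :=
  let e i := zcoord (nth [::] M i) (nth 0%N l (nth 0%N p i)) in
  (e 0%N + (e 1%N + (e 2%N + (e 3%N + 0))))%ZZ.

(** Values are counted with multiplicity, so a minimum attained by two permutations is counted
    twice. *)
Definition nonsingular (M : seq (seq Z)) (l : seq nat) : bool :=
  let V := [seq perm_value M l p | p <- permutations (iota 0 4)] in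
  count (fun v => all (Z.leb v) V) V == 1%N.

Definition generic_ok t : bool :=
  let I := iota 0 6 in
  all (fun a => all (fun b => all (fun c => all (fun d =>
    [&& a < b, b < c & c < d]%N ==> nonsingular (rows t) [:: a; b; c; d]) I) I) I) I.

Definition configuration_ok t : bool :=
  [&& size (points t) == 4%N, all (edge_ok t) (out_edges t), balanced_ok t, meet_ok t,
      positions_ok t & edges_in_pencil t] &&
  (generic_ok t && pencil_covered [seq edge_dbm t e | e <- out_edges t] (rows t) dfree).

Lemma configuration_okT t : word t = iota 1 5 -> configuration_ok t.
Proof.
have ok : all configuration_ok (plane_trees 5 (iota 1 5)) by vm_compute.
by move=> wt; apply: all_plane_trees ok wt _.
Qed.

(** * Soundness of the computations with difference constraints *)

Section DBMSoundness.
Variable R : realType.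
Implicit Types (a : 'rV[R]_6) (D : dbm) (x y : 'I_6) (J : nat -> bool).

Definition dsat a D : Prop :=
  forall x y, bounded_by (a 0 x - a 0 y) (omap (ofZ R) (dget D x y)).

Lemma dget_mk f (x y : nat) : (x < 6)%N -> (y < 6)%N -> dget (dmk f) x y = f x y.
Proof.
move=> x6 y6; rewrite /dget /dmk (nth_map 0%N) ?size_iota // nth_iota // add0n.
by rewrite (nth_map 0%N) ?size_iota // nth_iota // add0n.
Qed.

Lemma dsat_mk a f : dsat a (dmk f) <->
  forall x y, bounded_by (a 0 x - a 0 y) (omap (ofZ R) (f x y)).
Proof. by split=> h x y; have := h x y; rewrite dget_mk. Qed.

Lemma bounded_by_min (r : R) b b' : bounded_by r (omap (ofZ R) b) ->
  bounded_by r (omap (ofZ R) b') -> bounded_by r (omap (ofZ R) (omin b b')).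
Proof.
case: b b' => [d|] [d'|] //= h h'; have [e|e] : Z.min d d' = d \/ Z.min d d' = d' by lia.
  by rewrite e.
by rewrite e.
Qed.

Lemma bounded_by_add (r r' : R) b b' : bounded_by r (omap (ofZ R) b) ->
  bounded_by r' (omap (ofZ R) b') -> bounded_by (r + r') (omap (ofZ R) (oadd b b')).
Proof. by case: b b' => [d|] [d'|] //=; rewrite ofZD; exact: lerD. Qed.

Lemma ole_bound (r : R) b b' : ole b b' -> bounded_by r (omap (ofZ R) b) ->
  bounded_by r (omap (ofZ R) b').
Proof.
by case: b b' => [d|] [d'|] //=; rewrite -(ofZ_le R) => dd' h; exact: le_trans dd'.
Qed.

Lemma dsat_meet a D D' : dsat a D -> dsat a D' -> dsat a (dmeet D D').
Proof. by move=> h h'; apply/dsat_mk => x y; apply: bounded_by_min. Qed.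

Lemma dsat_close a D : dsat a D -> dsat a (dclose D).
Proof.
rewrite /dclose; have : all (fun k => k < 6)%N (iota 0 6) by [].
elim: (iota 0 6) D => //= k s IH D /andP[k6 s6] h; apply: IH s6 _.
apply/dsat_mk => x y; apply: bounded_by_min; first exact: h.
rewrite -(subrKA (a 0 (Ordinal k6)) (a 0 x)).
by apply: bounded_by_add; [exact: (h x (Ordinal k6))|exact: (h (Ordinal k6) y)].
Qed.

Lemma dsat_nonempty a D : dsat a D -> ~~ dempty D.
Proof.
move=> h; apply/hasPn => x; rewrite mem_iota => /= x6.
have := h (Ordinal x6) (Ordinal x6); rewrite /= subrr.
case: dget => //= d; rewrite -[0]/(ofZ R 0) ofZ_le => d0.
by rewrite Z.ltb_antisym d0.
Qed.

Lemma dsat_implies a D D' : dimplies D D' -> dsat a D -> dsat a D'.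
Proof.
move=> /allP imp h x y.
have := imp x; rewrite mem_iota ltn_ord => /(_ isT)/allP/(_ y).
by rewrite mem_iota ltn_ord => /(_ isT)/ole_bound; apply; exact: h.
Qed.

Definition zrow (p : seq Z) : 'rV[R]_6 := \row_x ofZ R (zcoord p x).

Lemma dsat_point a p : dsat a (dpoint p) -> tpeq a (zrow p).
Proof.
move=> /dsat_mk h; apply/tpeqP => x y; rewrite !mxE.
by have := h x y; have := h y x; rewrite /= !ofZB; lra.
Qed.

Lemma dsat_strip a p J c x0 y0 : J (val x0) -> ~~ J (val y0) ->
  strip (zrow p) (fun x => J (val x)) (omap (ofZ R) c) a <-> dsat a (dstrip p J c).
Proof.
move=> Jx Jy; apply: iff_trans (stripP _ _ _ Jx Jy) _.
apply: iff_trans (iff_sym (dsat_mk _ _)).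
have e x y : strip_bound (zrow p) (fun x => J (val x)) (omap (ofZ R) c) x y =
    omap (ofZ R) (if J x && ~~ J y then omap (Z.add (zcoord p x - zcoord p y)%ZZ) c
                  else Some (zcoord p x - zcoord p y)%ZZ).
  rewrite /strip_bound !mxE /=; case: ifP => _ /=; last by rewrite ofZB.
  by case: c => //= c; rewrite ofZD ofZB.
by split=> h x y; have := h x y; rewrite e.
Qed.

Definition zminimal (r : seq Z) a x : Prop :=
  forall z, a 0 x + ofZ R (zcoord r x) <= a 0 z + ofZ R (zcoord r z).

Lemma dsat_minimal a r x y : dsat a (dminimal r x y) <->
  zminimal r a x /\ zminimal r a y.
Proof.
apply: iff_trans (dsat_mk _ _) _; split=> [h|[hx hy] u z].
  by split=> z; [have := h x z|have := h y z]; rewrite eqxx ?orbT /= ofZB; lra.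
case: eqP => [/val_inj->|_] /=; first by have := hx z; rewrite ofZB; lra.
by case: eqP => [/val_inj->|_] //=; have := hy z; rewrite ofZB; lra.
Qed.

Definition zpencil (rows : seq (seq Z)) a : Prop := forall r, r \in rows ->
  exists x y, [/\ x != y, zminimal r a x & zminimal r a y].

(** Two minimal monomials of [a] at each row select a branch of the search; [a] satisfies all
    constraints collected on it, so the branch is not pruned and ends in one of the goals. *)
Lemma pencil_coveredP goals rows D a : pencil_covered goals rows D ->
  dsat a D -> zpencil rows a -> exists2 G, G \in goals & dsat a G.
Proof.
elim: rows D => [|r rows IH] D.
  rewrite /= => + h; rewrite (negPf (dsat_nonempty h)).
  by move=> /hasP[G Gin imp] _; exists G => //; exact: dsat_implies imp h.
have -> : pencil_covered goals (r :: rows) D = if dempty D then true else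
  all (fun e => pencil_covered goals rows (dclose (dmeet D (dminimal r e.1 e.2)))) pairs.
  by [].
move=> + h; rewrite (negPf (dsat_nonempty h)) => /allP cov pa.
have [x [y [xy mx my]]] := pa r (mem_head _ _).
have rec (x' y' : 'I_6) : (x' < y')%N -> zminimal r a x' -> zminimal r a y' ->
    exists2 G, G \in goals & dsat a G.
  move=> lt mx' my'; apply: (IH (dclose (dmeet D (dminimal r x' y')))).
  - apply: (cov (val x', val y')); rewrite /pairs mem_filter lt.
    by apply/allpairsP; exists (val x', val y'); rewrite !mem_iota !ltn_ord.
  - by apply/dsat_close/dsat_meet => //; apply/dsat_minimal.
  - by move=> r' r'in; apply: pa; rewrite in_cons r'in orbT.
by move: xy; rewrite neq_ltn => /orP[] lt; [exact: rec lt _ _|exact: rec lt _ _].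
Qed.

Lemma dsat_free a : dsat a dfree.
Proof.
by apply/dsat_mk => x y; case: eqP => //= /val_inj ->; rewrite subrr.
Qed.

End DBMSoundness.

Local Arguments Z.mul : simpl never.
Local Arguments Z.add : simpl never.
Lemma nth_enum_val n k (F : 'I_n -> 'I_k) (i : 'I_n) :
  nth 0%N [seq val (F j) | j <- enum 'I_n] i = F i.
Proof. by rewrite (nth_map i) ?size_enum_ord // nth_ord_enum. Qed.

(** * A checked configuration realizes its tree *)

Section Configuration.
Variables (R : realType) (t : bintree).
Hypothesis ok : configuration_ok t.

Definition config_point (i : 'I_4) : 'rV[R]_3 :=
  \row_j nth 0 [:: ofZ R (nth (0, 0)%ZZ (points t) i).1;
                   ofZ R (nth (0, 0)%ZZ (points t) i).2; 0] j.

Lemma size_points : size (points t) = 4%N.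
Proof. by case/andP: ok => /and5P[/eqP]. Qed.

Lemma size_rows : size (rows t) = 4%N.
Proof. by rewrite size_map size_points. Qed.

Lemma monomials_config (i : 'I_4) (x : 'I_6) :
  (monomials (config_point i))`_x = ofZ R (zcoord (nth [::] (rows t) i) x).
Proof.
rewrite /rows (nth_map (0, 0)%ZZ) ?size_points //.
have two : ofZ R 2 = 2 by [].
have zero : ofZ R 0 = 0 by [].
rewrite /monomials !mxE; set p := nth _ (points t) i.
case: x => -[|[|[|[|[|[|//]]]]]] x6;
  by rewrite /zcoord /zmonomials /= ?ofZD ?ofZM ?two ?zero.
Qed.

Lemma on_conic_config (a : 'rV[R]_6) i : on_conic a (config_point i) <->
  exists x y, [/\ x != y, zminimal (nth [::] (rows t) i) a x &
                  zminimal (nth [::] (rows t) i) a y].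
Proof.
split=> [[x [y [xy e le]]]|[x [y [xy mx my]]]]; exists x, y; split=> //.
- by move=> z; have := le z; rewrite !monomials_config.
- by move=> z; have := le z; rewrite e !monomials_config.
- by apply/eqP; rewrite eq_le !monomials_config mx my.
- by move=> z; rewrite !monomials_config mx.
Qed.

Lemma pencil_config a : pencil config_point a <-> zpencil (rows t) a.
Proof.
split=> [h r /(nthP [::])[i]|h i].
  rewrite size_rows => i4 <-.
  by apply/(on_conic_config a (Ordinal i4)); exact: h.
by apply/on_conic_config/h/mem_nth; rewrite size_rows.
Qed.

Lemma perm_value_config (f : 'I_4 -> 'I_6) (s : 'S_4) :
  \sum_(i < 4) colsub f (conic_matrix config_point) i (s i) =
  ofZ R (perm_value (rows t) [seq val (f i) | i <- enum 'I_4]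
           [seq val (s i) | i <- enum 'I_4]).
Proof.
have e (i : 'I_4) : colsub f (conic_matrix config_point) i (s i) =
    ofZ R (zcoord (nth [::] (rows t) i)
      (nth 0%N [seq val (f i) | i <- enum 'I_4]
        (nth 0%N [seq val (s i) | i <- enum 'I_4] i))).
  by rewrite !mxE monomials_config !nth_enum_val.
by rewrite !big_ord_recl big_ord0 /perm_value !ofZD !e.
Qed.

Lemma perm_in_permutations (s : 'S_4) :
  [seq val (s i) | i <- enum 'I_4] \in permutations (iota 0 4).
Proof.
rewrite mem_permutations; apply: uniq_perm.
- by rewrite map_inj_uniq ?enum_uniq // => i j /val_inj/perm_inj.
- exact: iota_uniq.
- move=> x; rewrite mem_iota; apply/mapP/idP => [[i _ ->]|x4]; first exact: ltn_ord.
  exists (s^-1%g (Ordinal x4)); first by rewrite mem_enum.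
  by rewrite permKV.
Qed.

Lemma perm_of_permutations p : p \in permutations (iota 0 4) ->
  exists s : 'S_4, [seq val (s i) | i <- enum 'I_4] = p.
Proof.
rewrite mem_permutations => pp.
have sp : size p = 4%N by rewrite (perm_size pp).
have lt (i : 'I_4) : (nth 0%N p i < 4)%N.
  have : nth 0%N p i \in iota 0 4 by rewrite -(perm_mem pp) mem_nth ?sp.
  by rewrite mem_iota.
have inj : injective (fun i => Ordinal (lt i)).
  move=> i j [] /eqP; rewrite nth_uniq ?sp ?ltn_ord //; last first.
    by rewrite (perm_uniq pp) iota_uniq.
  by move=> /eqP/val_inj.
exists (perm inj); apply: (@eq_from_nth _ 0%N).
  by rewrite size_map size_enum_ord sp.
move=> i; rewrite size_map size_enum_ord => i4.
by rewrite (nth_map ord0) ?size_enum_ord // permE /= -[i]/(val (Ordinal i4)) nth_ord_enum.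
Qed.

(** Two distinct permutations of minimal value would be two distinct minimal entries of the computed
    list of permutations, which has exactly one. *)
Lemma generic_config : generic config_point.
Proof.
move=> f hf [s [s' [ss' /= e le]]].
pose l := [seq val (f i) | i <- enum 'I_4].
have ns : nonsingular (rows t) l.
  have el : l = [:: val (f 0); val (f 1); val (f 2%:R); val (f 3%:R)].
    rewrite /l !enum_ordSl enum_ord0 /=.
    by congr [:: _; _; _; _]; congr (val (f _)); exact: val_inj.
  case/andP: ok => _ /andP[gen _]; move: gen.
  move=> /allP/(_ (val (f 0))); rewrite mem_iota ltn_ord => /(_ isT).
  move=> /allP/(_ (val (f 1))); rewrite mem_iota ltn_ord => /(_ isT).
  move=> /allP/(_ (val (f 2%:R))); rewrite mem_iota ltn_ord => /(_ isT).
  move=> /allP/(_ (val (f 3%:R))); rewrite mem_iota ltn_ord => /(_ isT).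
  by rewrite -el => /implyP; apply; rewrite !hf.
pose v (s0 : 'S_4) := [seq val (s0 i) | i <- enum 'I_4].
have vne : v s != v s'.
  apply: contra ss' => /eqP ev; apply/eqP/permP => i; apply: val_inj.
  have := congr1 (fun q => nth 0%N q i) ev.
  by rewrite !nth_enum_val.
move: ns; rewrite /nonsingular count_map => /eqP.
set P := preim _ _ => c1.
have Pmin (s0 : 'S_4) :
  (forall s1 : 'S_4, \sum_(i < 4) colsub f (conic_matrix config_point) i (s0 i)
    <= \sum_(i < 4) colsub f (conic_matrix config_point) i (s1 i)) -> P (v s0).
  move=> min; change (is_true (all (Z.leb (perm_value (rows t) l (v s0)))
    [seq perm_value (rows t) l p | p <- permutations (iota 0 4)])).
  rewrite all_map; apply/allP => p /perm_of_permutations[s1 <-].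
  by have := min s1; rewrite !perm_value_config ofZ_le.
have Ps : P (v s) := Pmin s le.
have Ps' : P (v s') by apply: (Pmin s') => s1; rewrite -e; exact: le.
have : v s \in seq.filter P (permutations (iota 0 4)).
  by rewrite mem_filter Ps perm_in_permutations.
have : v s' \in seq.filter P (permutations (iota 0 4)).
  by rewrite mem_filter Ps' perm_in_permutations.
rewrite -size_filter in c1; case: (seq.filter P _) c1 => [|q [|]] // _.
by rewrite !mem_seq1 => /eqP e1 /eqP e2; rewrite e1 e2 eqxx in vne.
Qed.

Section Line.
Variables (T : ltree 6) (x0 : T) (vs : seq T).
Hypothesis num : numbering t x0 vs.
Implicit Types (u v w : T) (a : 'rV[R]_6).
Local Notation ind := (index ^~ vs).

Definition config_pos v : 'rV[R]_6 := zrow R (position t (ind v)).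

Lemma ind_lt v : (ind v < 10)%N.
Proof. by have [_ svs invs _ _] := num; rewrite -svs index_mem. Qed.

Lemma nth_ind v : nth x0 vs (ind v) = v.
Proof. by have [_ _ invs _ _] := num; rewrite nth_index. Qed.

Lemma ind_inj u v : ind u = ind v -> u = v.
Proof. by move=> e; rewrite -(nth_ind u) e nth_ind. Qed.

Lemma ind_nth k : (k < 10)%N -> ind (nth x0 vs k) = k.
Proof. by have [uvs svs _ _ _] := num => k10; rewrite index_uniq ?svs. Qed.

Lemma ind_leaf (i : 'I_6) : ind (leaf T i) = i.
Proof.
have [_ _ _ lvs _] := num; rewrite -(lvs i) ind_nth //.
exact: ltn_trans (ltn_ord i) _.
Qed.

Lemma inner_ind v : inner v = (5 < ind v)%N.
Proof.
have [iv|/innerP[i ->]] := boolP (inner v); last by rewrite ind_leaf ltnNge -ltnS ltn_ord.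
apply/esym; rewrite ltnNge -ltnS; apply: contraL iv => i6.
apply/negPn/codomP; exists (Ordinal i6); apply: ind_inj.
by rewrite ind_leaf.
Qed.

Lemma adj_ind u v : adj u v = tree_edge t (ind u) (ind v).
Proof.
have [_ _ _ _ adjE] := num.
by rewrite -adjE ?ind_lt // !nth_ind.
Qed.

Lemma out_edge v w : inner v -> adj v w -> (ind v, ind w) \in out_edges t.
Proof.
rewrite inner_ind adj_ind => iv vw; rewrite /out_edges mem_filter vw andTb.
apply/allpairsP; exists (ind v, ind w); split=> //; rewrite mem_iota.
  by rewrite iv; exact: ind_lt.
exact: ind_lt.
Qed.

Definition out_pred v w : pred 'I_6 := fun x => out_set t (ind v) (ind w) (val x).

Lemma out_pred_leaf v i : out_pred v (leaf T i) =1 pred1 i.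
Proof. by move=> x; rewrite /out_pred /out_set ind_leaf ltn_ord. Qed.

Lemma out_pred_proper v w : inner v -> adj v w ->
  (exists x, out_pred v w x) /\ (exists y, ~~ out_pred v w y).
Proof.
move=> iv vw; case/andP: ok => /and5P[_ /allP/(_ _ (out_edge iv vw)) + _ _ _] _.
case/and3P=> /hasP[x + Jx] /hasP[y + Jy] _; rewrite !mem_iota => /= x6 y6.
by split; [exists (Ordinal x6)|exists (Ordinal y6)].
Qed.

Lemma config_edge v w : inner v -> inner w -> adj v w ->
  0 < ofZ R (edge_length t (ind v) (ind w)) /\
  tpeq (config_pos w) (config_pos v +
    ofZ R (edge_length t (ind v) (ind w)) *: indicator R (out_pred v w)).
Proof.
move=> iv iw vw; case/andP: ok => /and5P[_ /allP/(_ _ (out_edge iv vw)) + _ _ _] _.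
rewrite inner_ind in iw; case/and3P=> _ _ /orP[h|/andP[len /allP diff]].
  by have := leq_trans h iw; rewrite ltnn.
split; first by rewrite (ofZ_lt R 0).
have d x : ofZ R (zdiff (position t (ind v)) (position t (ind w)) (val x)) =
  ofZ R (zdiff_min (position t (ind v)) (position t (ind w))) +
  ofZ R (edge_length t (ind v) (ind w)) * (out_pred v w x)%:R.
  have := diff (val x); rewrite mem_iota ltn_ord => /(_ isT)/eqP ->.
  rewrite /out_pred /edge_length ofZB; case: out_set => /=; lra.
apply/tpeqP => x y; have := d x; have := d y.
rewrite /zdiff !ofZB !mxE; lra.
Qed.

Lemma config_cell v w a : inner v -> adj v w ->
  cell config_pos v w a <-> dsat a (edge_dbm t (ind v, ind w)).
Proof.
move=> iv vw; have [[x Jx] [y Jy]] := out_pred_proper iv vw.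
apply: iff_trans (dsat_strip _ _ _ Jx Jy).
have [iw|/innerP[i ew]] := boolP (inner w); last first.
  rewrite ew /= {2}ind_leaf ltn_ord /=.
  by apply: cell_ray; exact: out_pred_leaf.
have [c0 e] := config_edge iv iw vw.
rewrite inner_ind in iw; rewrite /= [(ind w < 6)%N]ltnNge iw /=.
by apply: cell_segment => //; rewrite inner_ind.
Qed.

Lemma config_embedded : embedded config_pos.
Proof.
split=> [v w iv iw /tpeqP e|v w v' w' iv iv' vw vw' ns a].
  apply: ind_inj; case/andP: ok => /and5P[_ _ _ _ /andP[/allP/(_ (ind v)) + _]] _.
  have in4 u : inner u -> ind u \in iota 6 4.
    by rewrite inner_ind mem_iota => -> /=; exact: ind_lt.
  move=> /(_ (in4 v iv))/allP/(_ _ (in4 w iw))/orP[/eqP //|/hasP[x]].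
  rewrite mem_iota => /= x6 /eqP[].
  apply: (@ofZ_inj R); rewrite /zdiff !ofZB.
  have := e (Ordinal x6) ord0; rewrite !mxE /=; lra.
move=> /(config_cell _ iv vw) h /(config_cell _ iv' vw') h'.
case/andP: ok => /and5P[_ _ _ /allP meet _] _.
have inE v1 w1 : inner v1 -> adj v1 w1 ->
    ((ind v1, ind w1), edge_dbm t (ind v1, ind w1)) \in
    [seq (e, edge_dbm t e) | e <- out_edges t].
  by move=> i1 a1; apply: map_f; exact: out_edge.
have /allP/(_ _ (inE _ _ iv' vw')) := meet _ (inE _ _ iv vw).
rewrite /meet_at; case: ifP => [/orP[]/eqP/= [/ind_inj e1 /ind_inj e2] _|_].
- by case: ns; left.
- by case: ns; right.
have hh := dsat_close (dsat_meet h h').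
rewrite (negPf (dsat_nonempty hh)) => /hasP[u].
rewrite mem_iota => /andP[u6 u10]; case: ifP => // /andP[uv uv'] imp.
exists (nth x0 vs u); split.
- by rewrite inner_ind ind_nth.
- by case/orP: uv => /eqP ->; rewrite nth_ind; [left|right].
- by case/orP: uv' => /eqP ->; rewrite nth_ind; [left|right].
- by rewrite /config_pos ind_nth //; apply/dsat_point/(dsat_implies imp).
Qed.

(** Some difference of two coordinates is 1, and it is a multiple of [k]. *)
Lemma indicator_primitive (J : pred 'I_6) x y : J x -> ~~ J y ->
  primitive (indicator int J).
Proof.
move=> Jx Jy k d /tpeqP/(_ x y); rewrite !mxE Jx (negPf Jy) /= => e.
have {}e : k * (d 0 x - d 0 y) = 1 by rewrite mulrBr -e.
move: (d 0 x - d 0 y) e => z e; have : (`|k| * `|z| = 1)%N by rewrite -abszM e.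
by move=> /eqP; rewrite muln_eq1 => /andP[/eqP k1 _]; rewrite -abszE k1.
Qed.

Lemma config_balanced v : inner v -> balanced config_pos v.
Proof.
move=> iv; exists (fun w => indicator int (out_pred v w)); split=> [w vw|].
  have [[x Jx] [y Jy]] := out_pred_proper iv vw.
  split; first exact: indicator_primitive Jx Jy.
  have [iw|/innerP[i ew]] := boolP (inner w); [right|left].
    have [c0 e] := config_edge iv iw vw; split=> //.
    exists (ofZ R (edge_length t (ind v) (ind w))) => //.
    have -> : map_mx intr (indicator int (out_pred v w)) = indicator R (out_pred v w).
      by apply/rowP => z; rewrite !mxE; case: out_pred.
    exact: e.
  exists i => //; apply/tpeqP => z z'.
  by rewrite ew !mxE !out_pred_leaf /= ?eqxx.
(* Each index lies in exactly one out-set, so the sum is (1, ..., 1) and the constant [- 1] brings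
   it to 0. *)
exists (- 1); apply/rowP => x; rewrite !mxE summxE.
have [uvs svs invs _ _] := num.
have -> : \sum_(w | adj v w) indicator int (out_pred v w) 0 x =
    \sum_(w <- vs | adj v w) indicator int (out_pred v w) 0 x.
  apply: perm_big; apply: uniq_perm => //; first exact: index_enum_uniq.
  by move=> w; rewrite invs mem_index_enum.
rewrite (big_nth x0) svs /index_iota subn0.
have -> : \sum_(k <- iota 0 10 | adj v (nth x0 vs k))
      indicator int (out_pred v (nth x0 vs k)) 0 x =
    (count (fun k => tree_edge t (ind v) k && out_set t (ind v) k x) (iota 0 10))%:R.
  have : all (fun k => k < 10)%N (iota 0 10) by [].
  elim: (iota 0 10) => [|k s IH]; first by rewrite big_nil.
  case/andP=> k10 /IH {}IH; rewrite big_cons IH /= adj_ind ind_nth //.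
  by case: tree_edge => //=; rewrite mxE /out_pred ind_nth // natrD.
case/andP: ok => /and5P[_ _ /allP/(_ (ind v)) + _ _] _.
rewrite mem_iota; rewrite inner_ind in iv; rewrite iv ind_lt => /(_ isT)/allP/(_ x).
by rewrite mem_iota ltn_ord => /(_ isT)/eqP ->; rewrite subrr.
Qed.

Lemma config_line : tropical_line config_pos.
Proof. by split; [exact: config_embedded | exact: config_balanced]. Qed.

(** From line to pencil, the constraints of each cell imply a pair of minimal monomials at each
    point. Conversely, the search [pencil_covered] puts every point of the pencil into the
    constraints of some cell. *)
Lemma config_support : line_support config_pos = pencil config_point.
Proof.
apply/seteqP; split=> a /=.
  case=> v [w [iv vw /(config_cell _ iv vw) h]]; apply/pencil_config => r rin.
  case/andP: ok => /and5P[_ _ _ _ /andP[_ /allP/(_ _ (out_edge iv vw)) +]] _.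
  move=> in_pencil; have {in_pencil} : all (fun r => has (fun xy =>
    dimplies (edge_dbm t (ind v, ind w)) (dminimal r xy.1 xy.2)) pairs) (rows t).
    exact: in_pencil.
  move=> /allP/(_ r rin)/hasP[xy]; rewrite /pairs mem_filter => /andP[lt].
  case/allpairsP => -[x y]; rewrite !mem_iota => -[x6 y6 exy] imp.
  rewrite exy in lt imp.
  have /dsat_minimal[mx my] := dsat_implies (D' := dminimal r (Ordinal x6) (Ordinal y6)) imp h.
  by exists (Ordinal x6), (Ordinal y6); split=> //; rewrite neq_ltn lt.
move=> /pencil_config pa; case/andP: ok => _ /andP[_ cov].
have [D /mapP[[j k] + ->] h] := pencil_coveredP cov (dsat_free a) pa.
rewrite /out_edges mem_filter => /andP[jk /allpairsP[[j' k']]].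
rewrite !mem_iota => -[/andP[j6 j10] k10 [ej ek]].
rewrite -ej in j6 j10; rewrite -ek in k10.
have iv : inner (nth x0 vs j) by rewrite inner_ind ind_nth.
have vw : adj (nth x0 vs j) (nth x0 vs k) by rewrite adj_ind !ind_nth.
exists (nth x0 vs j), (nth x0 vs k); split=> //.
by apply/(config_cell _ iv vw); rewrite !ind_nth.
Qed.

End Line.
End Configuration.

Lemma numbering_realizable (R : realType) (T : ltree 6) t x0 vs :
  word t = iota 1 5 -> @numbering T t x0 vs -> realizable_by_pencil R T.
Proof.
move=> wt num; have ok := configuration_okT wt.
exists (config_point R t); first by apply: generic_config.
exists T, (config_pos R t vs); split.
- by apply: config_line num.
- by apply: config_support num.
- exists id; split=> //; by exists id.
Qed.

(** * Isomorphic trees *)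

Lemma connect_homo (I I' : finType) (e : rel I) (e' : rel I') (h : I -> I') x y :
  (forall a b, e a b -> e' (h a) (h b)) -> connect e x y -> connect e' (h x) (h y).
Proof.
move=> he /connectP[p pp ->]; elim: p x pp => [|z p IH] x //=.
by case/andP=> /he/connect1 xz /IH; exact: connect_trans.
Qed.

Section Isomorphism.
Variables (n : nat) (T1 T2 : ltree n).
Hypothesis iso : ltree_iso T1 T2.

(** The tree carrying the tropical line is only isomorphic to the given one: trivalency is
    transported to it, and the absence of crossing splits back. *)
Lemma iso_trivalent : trivalent T2 -> trivalent T1.
Proof.
have [f [fbij fadj fleaf]] := iso; have finj := bij_inj fbij.
move=> T23 v iv.
have ifv : inner (f v).
  have [//|/innerP[i ev]] := boolP (inner (f v)).
  by move: iv; rewrite (finj v (leaf T1 i)) ?inner_leaf // fleaf.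
rewrite -(T23 _ ifv) -(fintype.card_image finj); apply: eq_card => y.
have [g fK gK] := fbij.
apply/fintype.imageP/idP => [[x xv ->]|yv].
  by move: xv; rewrite -[_ \in _]/(adj v x) -[_ \in _]/(adj (f v) (f x)) fadj.
by exists (g y); rewrite ?gK // -[_ \in _]/(adj v (g y)) -fadj gK.
Qed.

Lemma iso_noncrossing : noncrossing T1 -> noncrossing T2.
Proof.
have [f [[g fK gK] fadj fleaf]] := iso.
have gadj u v : adj (g u) (g v) = adj u v by rewrite -fadj !gK.
have gleaf i : g (leaf T2 i) = leaf T1 i by rewrite -fleaf fK.
have gbranch v w i : branch v w (leaf T2 i) -> branch (g v) (g w) (leaf T1 i).
  rewrite -gleaf; apply: connect_homo => a b.
  by rewrite /off gadj !(can_eq gK).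
move=> nc v w vw a b c d ab bc cd [ha hc hb hd].
by apply: (nc (g v) (g w) _ a b c d ab bc cd); rewrite ?gadj //; split; exact: gbranch.
Qed.

End Isomorphism.

Theorem theorem6p1 (R : realType) (Gamma : ltree 6) (hGamma : trivalent Gamma) :
  realizable_by_pencil R Gamma <-> planar_in_cyclic_order R Gamma.
Proof.
split=> [[P _ [T [pos [line supp iso]]]]|[pt [arc [emb ord]]]].
  have nc := iso_noncrossing iso (tropical_noncrossing (iso_trivalent iso hGamma) line supp).
  have [t [x0 [vs [wt num]]]] := noncrossing_numbering hGamma nc.
  exact: numbering_planar wt num.
have [t [x0 [vs [wt num]]]] := noncrossing_numbering hGamma (planar_noncrossing emb ord).
exact: numbering_realizable wt num.
Qed.
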